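(* Let $(I,A,\cdot)$ be a Borcherds-Cartan datum, $\nu\in\mathbb N[I]$ with $n=\mathrm{ht}(\nu)$, and $\mathbf i,\mathbf j\in\mathrm{Seq}(\nu)$. Let ${}_{\mathbf j}\mathcal S_{\mathbf i}=\{\omega\in S_n\mid\omega(\mathbf i)=\mathbf j\}$, and for each $\omega\in{}_{\mathbf j}\mathcal S_{\mathbf i}$ fix a reduced expression, determining an element $\widehat\omega_{\mathbf i}\in{}_{\mathbf j}R(\nu)_{\mathbf i}=1_{\mathbf j}R(\nu)1_{\mathbf i}$. Then $${}_{\mathbf j}\mathcal B_{\mathbf i}=\{\widehat\omega_{\mathbf i}\cdot x_{1,\mathbf i}^{r_1}\cdots x_{n,\mathbf i}^{r_n}\mid\omega\in{}_{\mathbf j}\mathcal S_{\mathbf i},\ r_1,\dots,r_n\in\mathbb N\}$$ is a $\mathbb K$-basis of ${}_{\mathbf j}R(\nu)_{\mathbf i}$. Moreover, the polynomial representation $\mathscr P_\nu$ is a faithful $R(\nu)$-module.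
   Context: $\mathbb K$ is a fixed algebraically closed field. **Borcherds-Cartan datum.** $I$ is a finite set; $A=(a_{ij})_{i,j\in I}$ is an integer matrix with $a_{ii}\in\{2,0,-2,-4,\dots\}$, $a_{ij}\in\mathbb Z_{\le 0}$ for $i\neq j$, and there are $r_i\in\mathbb Z_{>0}$ ($i\in I$) such that $DA$ is symmetric, $D=\mathrm{diag}(r_i)$; $i\cdot j=r_ia_{ij}=r_ja_{ji}$. Put $I^+=\{i: a_{ii}=2\}$, $I^-=\{i: a_{ii}\le 0\}$. $\Lambda$ is the graph with vertex set $I$ and an edge between $i$ and $j$ if $i\cdot j\ne0$; an orientation of each edge is chosen. **Algebras $R(\nu)$.** For $\nu=\sum\nu_i i\in\mathbb N[I]$ with $n=\mathrm{ht}(\nu)=\sum_i\nu_i$, let $\mathrm{Seq}(\nu)$ be the set of sequences $\mathbf i=i_1\dots i_n$ in $I$ with $i_1+\dots+i_n=\nu$. $S_n=\langle s_1,\dots,s_{n-1}\rangle$ acts on $\mathrm{Seq}(\nu)$ by permuting places ($\omega$ moves the $a$-th entry to position $\omega(a)$). $R(\nu)$ is the graded $\mathbb K$-algebra generated by orthogonal idempotents $1_{\mathbf i}$ with $\sum_{\mathbf i}1_{\mathbf i}=1$ (degree $0$), $x_{k,\mathbf i}=1_{\mathbf i}x_{k,\mathbf i}1_{\mathbf i}$ ($1\le k\le n$, degree $2r_{i_k}$), $\tau_{k,\mathbf i}=1_{s_k\mathbf i}\tau_{k,\mathbf i}1_{\mathbf i}$ ($1\le k\le n-1$, degree $-i_k\cdot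 i_{k+1}$), subject, with $x_k=\sum_{\mathbf i}x_{k,\mathbf i}$, $\tau_k=\sum_{\mathbf i}\tau_{k,\mathbf i}$, to: $x_kx_l=x_lx_k$; $\tau_kx_l=x_l\tau_k$ for $l\ne k,k+1$; $\tau_k\tau_l=\tau_l\tau_k$ for $|k-l|>1$; $\tau_k^21_{\mathbf i}=0$ if $i_k=i_{k+1}$, $=1_{\mathbf i}$ if $i_k\ne i_{k+1}$ and $i_k\cdot i_{k+1}=0$, $=(x_k^{-a_{i_ki_{k+1}}}+x_{k+1}^{-a_{i_{k+1}i_k}})1_{\mathbf i}$ if $i_k\neq i_{k+1}$ and $i_k\cdot i_{k+1}\ne0$; $(x_k\tau_k-\tau_kx_{k+1})1_{\mathbf i}=(\tau_kx_k-x_{k+1}\tau_k)1_{\mathbf i}=1_{\mathbf i}$ if $i_k=i_{k+1}\in I^+$, and both are $0$ otherwise; $(\tau_k\tau_{k+1}\tau_k-\tau_{k+1}\tau_k\tau_{k+1})1_{\mathbf i}=\sum_{c=0}^{-a_{ij}-1}x_k^cx_{k+2}^{-a_{ij}-1-c}1_{\mathbf i}$ if $i_k=i_{k+2}=i\in I^+$, $i_{k+1}=j\ne i$, $i\cdot j\neq0$, and $=0$ otherwise. (This is the algebraic form of the diagrammatic presentation by strands, dots and crossings.) For a reduced expression $\omega=s_{k_1}\cdots s_{k_r}$, $\widehat\omega_{\mathbf i}=\tau_{k_1}\cdots\tau_{k_r}1_{\mathbf i}$. **Polynomial representation.** $\mathscr P_{\mathbf i}=\mathbb K[x_1(\mathbf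 i),\dots,x_n(\mathbf i),y_1(\mathbf i),\dots,y_n(\mathbf i)]$ and $\mathscr P_\nu=\bigoplus_{\mathbf i\in\mathrm{Seq}(\nu)}\mathscr P_{\mathbf i}$. For $\omega\in S_n$ let $\omega$ act by the algebra maps $\mathscr P_{\mathbf i}\to\mathscr P_{\omega(\mathbf i)}$, $x_a(\mathbf i)\mapsto x_{\omega(a)}(\omega(\mathbf i))$, $y_a(\mathbf i)\mapsto y_{\omega(a)}(\omega(\mathbf i))$, and let $\widetilde\omega$ act by $x_a(\mathbf i)\mapsto x_{\omega(a)}(\omega(\mathbf i))$, $y_a(\mathbf i)\mapsto y_a(\omega(\mathbf i))$. The action: ${}_{\mathbf j}R(\nu)_{\mathbf i}$ acts by $0$ on $\mathscr P_{\mathbf k}$ for $\mathbf k\neq\mathbf i$; for $f\in\mathscr P_{\mathbf i}$, $1_{\mathbf i}f=f$, $x_{k,\mathbf i}f=x_k(\mathbf i)f$, and $\tau_{k,\mathbf i}f$ equals - $s_kf$ if $i_k\ne i_{k+1}$, $i_k\cdot i_{k+1}=0$; - $\frac{f-\widetilde s_kf}{x_k(\mathbf i)-x_{k+1}(\mathbf i)}$ if $i_k=i_{k+1}\in I^+$; - $\frac{\widetilde s_kf-s_kf}{y_k(\mathbf i)-y_{k+1}(\mathbf i)}$ if $i_k=i_{k+1}\in I^-$; - $s_kf$ if $i_k\ne i_{k+1}$ are joined by an edge oriented $i_k\leftarrow i_{k+1}$; - $(x_k(s_k\mathbf i)^{-a_{ji}}+x_{k+1}(s_k\mathbf i)^{-a_{ij}})\,s_kf$,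 with $i=i_k$, $j=i_{k+1}$, if $i_k\neq i_{k+1}$ are joined by an edge oriented $i_k\to i_{k+1}$. *)

(* Defs.v *)
From HB Require Import structures.
From mathcomp Require Import all_boot all_order all_algebra all_fingroup.
From mathcomp Require Import generic_quotient ring_quotient boolp.
(* The notations and lemma names of monalg clash with those of mpoly, which is
   imported after the free algebra. *)
From mathcomp Require Import -(notations) monalg.

Set Implicit Arguments.
Unset Strict Implicit.
Unset Printing Implicit Defensive.

Import GRing.Theory Num.Theory.

Local Open Scope ring_scope.
Local Open Scope quotient_scope.

Section FreeAlgebra.
Context (K : comNzRingType) (X : choiceType).

Definition free_alg : Type := malg (fmonom X) K.

HB.instance Definition _ := GRing.Lalgebra.on free_alg.

Fact free_alg_scalerAr (k : K) (u v : free_alg) : k *: (u * v) = u * (k *: v).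
Proof.
apply/malgP => m; rewrite mcoeffZ (mcoeffMlw (d1 := msupp u) (d2 := msupp v)) //.
rewrite (mcoeffMlw (d1 := msupp u) (d2 := msupp v)) ?msuppZ_le //.
rewrite mulr_sumr; apply: eq_bigr => m1 _; rewrite mulr_sumr.
by apply: eq_bigr => m2 _; rewrite mcoeffZ mulrnAr mulrCA.
Qed.

HB.instance Definition _ :=
  GRing.Lalgebra_isAlgebra.Build K free_alg free_alg_scalerAr.

Definition free_gen (x : X) : free_alg := mkmalgU (fmu x) 1.

End FreeAlgebra.

From mathcomp Require Import mpoly.

Section PresentedAlgebra.
Context (K : comNzRingType) (A : algType K) (rel : A -> A -> Prop).

Inductive relation_ideal : A -> Prop :=
| ideal_zero : relation_ideal 0
| ideal_step (a b u v w : A) :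
    rel u v -> relation_ideal w -> relation_ideal (a * (u - v) * b + w).

Definition relation_ideal_pred : {pred A} := [pred w | `[< relation_ideal w >]].

Lemma relation_idealP (w : A) :
  reflect (relation_ideal w) (w \in relation_ideal_pred).
Proof. by rewrite inE; apply: asboolP. Qed.

Lemma relation_idealD (w1 w2 : A) :
  relation_ideal w1 -> relation_ideal w2 -> relation_ideal (w1 + w2).
Proof.
move=> h1 h2; elim: h1 => [|a b u v w uv _ IH]; first by rewrite add0r.
by rewrite -addrA; apply: ideal_step.
Qed.

Lemma relation_idealMl (c w : A) : relation_ideal w -> relation_ideal (c * w).
Proof.
elim=> [|a b u v z uv _ IH]; first by rewrite mulr0; apply: ideal_zero.
by rewrite mulrDr !mulrA; apply: ideal_step.
Qed.

Lemma relation_idealMr (c w : A) : relation_ideal w -> relation_ideal (w * c).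
Proof.
elim=> [|a b u v z uv _ IH]; first by rewrite mul0r; apply: ideal_zero.
by rewrite mulrDl -mulrA; apply: ideal_step.
Qed.

Lemma relation_ideal_gen (u v : A) : rel u v -> relation_ideal (u - v).
Proof.
move=> uv; have := ideal_step 1 1 uv ideal_zero.
by rewrite mul1r mulr1 addr0.
Qed.

Fact relation_ideal_zmod_closed : zmod_closed relation_ideal_pred.
Proof.
split=> [|x y /relation_idealP hx /relation_idealP hy].
  exact/relation_idealP/ideal_zero.
apply/relation_idealP/relation_idealD => //.
by rewrite -mulN1r; apply: relation_idealMl.
Qed.

HB.instance Definition _ :=
  GRing.isZmodClosed.Build A relation_ideal_pred relation_ideal_zmod_closed.

(* The quotient is not known to be nontrivial for arbitrary relations, so it is
   a pzRingType and an lmodType rather than an algType. *)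
Definition presented : Type := Quotient.quot relation_ideal_pred.

HB.instance Definition _ := GRing.Zmodule.on presented.

Definition presented_pi (a : A) : presented :=
  \pi_(Quotient.quot relation_ideal_pred) a.

Lemma presented_piP (a b : A) :
  presented_pi a = presented_pi b <-> relation_ideal (a - b).
Proof.
split=> [h|h].
  by apply/relation_idealP; rewrite Quotient.idealrBE; apply/eqP.
by apply/eqP; rewrite /presented_pi -Quotient.idealrBE; apply/relation_idealP.
Qed.

Lemma presented_repr (x : presented) : {a : A | x = presented_pi a}.
Proof. by exists (repr x); rewrite /presented_pi reprK. Qed.

Lemma presented_piD (a b : A) :
  presented_pi (a + b) = presented_pi a + presented_pi b.
Proof. exact: (raddfD (\pi_(Quotient.quot relation_ideal_pred))). Qed.

Definition presented_one : presented := presented_pi 1.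
Definition presented_mul (x y : presented) : presented :=
  presented_pi (projT1 (presented_repr x) * projT1 (presented_repr y)).
Definition presented_scale (k : K) (x : presented) : presented :=
  presented_pi (k *: projT1 (presented_repr x)).

Lemma presented_mulE (a b : A) :
  presented_mul (presented_pi a) (presented_pi b) = presented_pi (a * b).
Proof.
rewrite /presented_mul; case: presented_repr => a' /= /presented_piP ha.
case: presented_repr => b' /= /presented_piP hb; apply/presented_piP.
rewrite -[_ - _]opprK; have -> : - (a' * b' - a * b) =
    (a - a') * b' + a * (b - b').
  by rewrite mulrBl mulrBr opprB [RHS]addrC addrA addrNK.
rewrite -mulN1r; apply/relation_idealMl/relation_idealD.
  exact: relation_idealMr.
exact: relation_idealMl.
Qed.

Lemma presented_scaleE (k : K) (a : A) :
  presented_scale k (presented_pi a) = presented_pi (k *: a).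
Proof.
rewrite /presented_scale; case: presented_repr => a' /= /presented_piP ha.
apply/presented_piP; rewrite -scalerBr -[a' - a]opprB -scaleN1r scalerA.
by rewrite -[a - a']mul1r scalerAl; apply: relation_idealMl.
Qed.

Local Ltac lift x := have [? ->] := presented_repr x.

Fact presented_mulA : associative presented_mul.
Proof. by move=> x y z; lift x; lift y; lift z; rewrite !presented_mulE mulrA. Qed.

Fact presented_mul1 : left_id presented_one presented_mul.
Proof. by move=> x; lift x; rewrite presented_mulE mul1r. Qed.

Fact presented_mulr1 : right_id presented_one presented_mul.
Proof. by move=> x; lift x; rewrite presented_mulE mulr1. Qed.

Fact presented_mulDl : left_distributive presented_mul +%R.
Proof.
move=> x y z; lift x; lift y; lift z.
by rewrite -presented_piD !presented_mulE mulrDl presented_piD.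
Qed.

Fact presented_mulDr : right_distributive presented_mul +%R.
Proof.
move=> x y z; lift x; lift y; lift z.
by rewrite -presented_piD !presented_mulE mulrDr presented_piD.
Qed.

HB.instance Definition _ := GRing.Zmodule_isPzRing.Build presented
  presented_mulA presented_mul1 presented_mulr1 presented_mulDl presented_mulDr.

Fact presented_scaleA (k l : K) (x : presented) :
  presented_scale k (presented_scale l x) = presented_scale (k * l) x.
Proof. by lift x; rewrite !presented_scaleE scalerA. Qed.

Fact presented_scale1 : left_id 1 presented_scale.
Proof. by move=> x; lift x; rewrite presented_scaleE scale1r. Qed.

Fact presented_scaleDr : right_distributive presented_scale +%R.
Proof.
move=> k x y; lift x; lift y.
by rewrite -presented_piD !presented_scaleE scalerDr presented_piD.
Qed.

Fact presented_scaleDl (x : presented) :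
  {morph presented_scale^~ x : k l / k + l}.
Proof.
by move=> k l; lift x; rewrite !presented_scaleE scalerDl presented_piD.
Qed.

HB.instance Definition _ := GRing.Zmodule_isLmodule.Build K presented
  presented_scaleA presented_scale1 presented_scaleDr presented_scaleDl.

Lemma presented_piM (a b : A) :
  presented_pi (a * b) = presented_pi a * presented_pi b.
Proof. by rewrite -presented_mulE. Qed.

Lemma presented_piZ (k : K) (a : A) :
  presented_pi (k *: a) = k *: presented_pi a.
Proof. by rewrite -presented_scaleE. Qed.

Lemma presented_scalerAl (k : K) (x y : presented) :
  k *: (x * y) = (k *: x) * y.
Proof.
by lift x; lift y; rewrite -presented_piM -!presented_piZ -presented_piM scalerAl.
Qed.

Lemma presented_scalerAr (k : K) (x y : presented) :
  k *: (x * y) = x * (k *: y).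
Proof.
by lift x; lift y; rewrite -presented_piM -!presented_piZ -presented_piM scalerAr.
Qed.

End PresentedAlgebra.

Record bc_datum (I : finType) := BCDatum {
  cartan : I -> I -> int;
  symmetrizer : I -> nat;
  cartan_diag : forall i, cartan i i = 2 \/
    (cartan i i <= 0 /\ (2 %| cartan i i)%Z);
  cartan_offdiag : forall i j, i != j -> cartan i j <= 0;
  symmetrizer_gt0 : forall i, (0 < symmetrizer i)%N;
  cartan_symmetric : forall i j,
    (symmetrizer i)%:Z * cartan i j = (symmetrizer j)%:Z * cartan j i
}.

Section Datum.
Context (I : finType) (D : bc_datum I).

Definition dotp (i j : I) : int := (symmetrizer D i)%:Z * cartan D i j.

Definition plus_vertex (i : I) : bool := cartan D i i == 2.

Definition adjacent (i j : I) : bool := (i != j) && (dotp i j != 0).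

(* arrow i j: the edge between i and j is oriented i -> j. *)
Record orientation := Orientation {
  arrow : rel I;
  arrow_edge : forall i j, arrow i j -> adjacent i j;
  arrow_total : forall i j, adjacent i j -> arrow i j (+) arrow j i
}.

(* The exponent - a_ij, for i != j. *)
Definition expo (i j : I) : nat := `|cartan D i j|%N.

End Datum.

Section Sequences.
Context (I : finType) (nu : {ffun I -> nat}).

Definition ht : nat := (\sum_i nu i)%N.

Definition is_seq (t : ht.-tuple I) : bool :=
  [forall c, count_mem c t == nu c].

Definition Seq : Type := {t : ht.-tuple I | is_seq t}.

HB.instance Definition _ := Finite.on Seq.

Definition entry (s : Seq) (a : 'I_ht) : I := tnth (val s) a.

(* Entry a moves to position w a. *)
Definition place (w : 'S_ht) (t : ht.-tuple I) : ht.-tuple I :=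
  [tuple tnth t ((w^-1)%g b) | b < ht].

Fact place_is_seq (w : 'S_ht) (s : Seq) : is_seq (place w (val s)).
Proof.
apply/forallP => c; have /forallP/(_ c)/eqP <- := valP s.
have /seq.permP -> // : perm_eq (place w (val s)) (val s).
rewrite perm_sym; apply/tuple_permP; exists w; congr tval.
by apply: eq_from_tnth => a; rewrite !tnth_mktuple permK.
Qed.

Definition seq_act (w : 'S_ht) (s : Seq) : Seq :=
  exist _ (place w (val s)) (place_is_seq w s).

(* The k-th and (k+1)-st positions, for k : 'I_ht.-1. *)
Definition pos (k : 'I_ht.-1) : 'I_ht := widen_ord (leq_pred ht) k.

Fact posS_subproof (k : 'I_ht.-1) : (k.+1 < ht)%N.
Proof. by case: k => k /=; case: ht. Qed.

Definition posS (k : 'I_ht.-1) : 'I_ht := Ordinal (posS_subproof k).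

Definition simple (k : 'I_ht.-1) : 'S_ht := tperm (pos k) (posS k).

(* In 'S_n, p * q is p followed by q: this is s_(k_1) o ... o s_(k_r). *)
Definition word_perm (ks : seq 'I_ht.-1) : 'S_ht :=
  foldr (fun k p => (p * simple k)%g) 1%g ks.

Definition reduced_expression (w : 'S_ht) (ks : seq 'I_ht.-1) : Prop :=
  word_perm ks = w /\
  forall ks', word_perm ks' = w -> (size ks <= size ks')%N.

(* The permutations taking i to j. *)
Definition transporter (i j : Seq) : Type := {w : 'S_ht | seq_act w i == j}.

HB.instance Definition _ (i j : Seq) := Finite.on (transporter i j).

End Sequences.

Section Algebra.
Context (K : closedFieldType) (I : finType) (D : bc_datum I).
Context (nu : {ffun I -> nat}).

Local Notation n := (ht nu).
Local Notation Seq := (Seq nu).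

Definition generators : Type := (Seq + ('I_n * Seq) + ('I_n.-1 * Seq))%type.

HB.instance Definition _ := Choice.on generators.

Local Notation F := (free_alg K generators).

Definition idem_gen (i : Seq) : F :=
  free_gen K (inl (inl i) : generators).
Definition dot_gen (k : 'I_n) (i : Seq) : F :=
  free_gen K (inl (inr (k, i)) : generators).
Definition cross_gen (k : 'I_n.-1) (i : Seq) : F :=
  free_gen K (inr (k, i) : generators).

Local Notation e := idem_gen.
Local Notation s k i := (seq_act (simple k) i).
Local Notation x k := (\sum_i dot_gen k i).
Local Notation t k := (\sum_i cross_gen k i).

Inductive klr_relation : F -> F -> Prop :=
| rel_idem (i j : Seq) : klr_relation (e i * e j) (if i == j then e i else 0)
| rel_unit : klr_relation (\sum_i e i) 1
| rel_dot_ends (k : 'I_n) (i : Seq) : klr_relation (e i * dot_gen k i * e i) (dot_gen k i)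
| rel_cross_ends (k : 'I_n.-1) (i : Seq) :
    klr_relation (e (s k i) * cross_gen k i * e i) (cross_gen k i)
| rel_dot_dot (k l : 'I_n) : klr_relation (x k * x l) (x l * x k)
| rel_cross_dot (k : 'I_n.-1) (l : 'I_n) : l != pos k -> l != posS k ->
    klr_relation (t k * x l) (x l * t k)
| rel_cross_cross (k l : 'I_n.-1) : (k.+1 < l)%N || (l.+1 < k)%N ->
    klr_relation (t k * t l) (t l * t k)
| rel_cross_square (k : 'I_n.-1) (i : Seq) :
    let a := entry i (pos k) in
    let b := entry i (posS k) in
    klr_relation (t k * t k * e i)
      (if a == b then 0
       else if dotp D a b == 0 then e i
       else (x (pos k) ^+ expo D a b + x (posS k) ^+ expo D b a) * e i)
| rel_slide_left (k : 'I_n.-1) (i : Seq) :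
    let a := entry i (pos k) in
    let b := entry i (posS k) in
    klr_relation ((x (pos k) * t k - t k * x (posS k)) * e i)
      (if (a == b) && plus_vertex D a then e i else 0)
| rel_slide_right (k : 'I_n.-1) (i : Seq) :
    let a := entry i (pos k) in
    let b := entry i (posS k) in
    klr_relation ((t k * x (pos k) - x (posS k) * t k) * e i)
      (if (a == b) && plus_vertex D a then e i else 0)
| rel_braid (k l : 'I_n.-1) (i : Seq) : l = k.+1 :> nat ->
    let a := entry i (pos k) in
    let b := entry i (pos l) in
    let c := entry i (posS l) in
    klr_relation ((t k * t l * t k - t l * t k * t l) * e i)
      (if [&& a == c, plus_vertex D a, b != a & dotp D a b != 0]
       then \sum_(m < expo D a b)
              x (pos k) ^+ m * x (posS l) ^+ (expo D a b - 1 - m) * e i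
       else 0).

Definition klr : Type := presented klr_relation.

HB.instance Definition _ := GRing.PzRing.on klr.
HB.instance Definition _ := GRing.Lmodule.on klr.

Definition idem (i : Seq) : klr := presented_pi klr_relation (idem_gen i).
Definition dot (k : 'I_n) (i : Seq) : klr :=
  presented_pi klr_relation (dot_gen k i).
Definition cross (k : 'I_n.-1) (i : Seq) : klr :=
  presented_pi klr_relation (cross_gen k i).

Definition corner (j i : Seq) (a : klr) : Prop :=
  exists b : klr, a = idem j * b * idem i.

Definition cross_word (ks : seq 'I_n.-1) (i : Seq) : klr :=
  (\prod_(k <- ks) \sum_j cross k j) * idem i.

Definition basis_element (i : Seq) (ks : seq 'I_n.-1) (m : {ffun 'I_n -> nat}) :
    klr :=
  cross_word ks i * \prod_(k < n) dot k i ^+ m k.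

End Algebra.

Definition is_basis (K : pzRingType) (V : lmodType K) (W : V -> Prop)
    (T : eqType) (b : T -> V) : Prop :=
  [/\ forall t, W (b t),
      forall v, W v -> exists (ts : seq T) (c : T -> K),
        v = \sum_(t <- ts) c t *: b t
    & forall (ts : seq T) (c : T -> K), uniq ts ->
        \sum_(t <- ts) c t *: b t = 0 -> forall t, t \in ts -> c t = 0].

Section PolynomialRepresentation.
Context (K : closedFieldType) (I : finType) (D : bc_datum I).
Context (O : orientation D) (nu : {ffun I -> nat}).

Local Notation n := (ht nu).
Local Notation Seq := (Seq nu).

(* The first n variables are the x_k(i), the last n are the y_k(i); the ring
   does not depend on i. *)
Local Notation pol := {mpoly K[n + n]}.

Definition varx (k : 'I_n) : pol := 'X_(lshift n k).
Definition vary (k : 'I_n) : pol := 'X_(rshift n k).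

Definition Pol : Type := {ffun Seq -> pol}.

HB.instance Definition _ := GRing.Lmodule.on Pol.

(* x_a |-> x_(p a) and y_a |-> y_(q a) *)
Definition permute (p q : 'S_n) (f : pol) : pol :=
  comp_mpoly [tuple match split v with
                    | inl a => varx (p a)
                    | inr a => vary (q a)
                    end | v < n + n] f.

Definition perm_xy (w : 'S_n) : pol -> pol := permute w w.
Definition perm_x (w : 'S_n) : pol -> pol := permute w 1%g.

(* The quotient f / g when g divides f, and 0 otherwise. *)
Definition exact_div (f g : pol) : pol :=
  if pselect (exists h, f = h * g) is left ex then projT1 (cid ex) else 0.

Lemma exact_divK (f g : pol) :
  (exists h, f = h * g) -> exact_div f g * g = f.
Proof.
by move=> ex; rewrite /exact_div; case: pselect => // ex'; case: cid.
Qed.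

Definition cross_pol (i : Seq) (k : 'I_n.-1) (f : pol) : pol :=
  let a := entry i (pos k) in
  let b := entry i (posS k) in
  let sf := perm_xy (simple k) f in
  let stf := perm_x (simple k) f in
  if a == b then
    if plus_vertex D a then exact_div (f - stf) (varx (pos k) - varx (posS k))
    else exact_div (stf - sf) (vary (pos k) - vary (posS k))
  else if dotp D a b == 0 then sf
  else if arrow O b a then sf
  else (varx (pos k) ^+ expo D b a + varx (posS k) ^+ expo D a b) * sf.

Lemma comp_mpoly_div (g : pol) (p q : (n + n).-tuple pol) :
  (forall v, exists h, tnth p v - tnth q v = h * g) ->
  forall f : pol, exists h, comp_mpoly p f - comp_mpoly q f = h * g.
Proof.
move=> hv f; elim/mpolyind: f => [|c m f _ _ [h hf]].
  by exists 0; rewrite !comp_mpoly0 subrr mul0r.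
suff [h' hm] : exists h', comp_mpoly p 'X_[m] - comp_mpoly q 'X_[m] = h' * g.
  exists (c *: h' + h); rewrite !comp_mpolyD !comp_mpolyZ mulrDl -scalerAl.
  by rewrite -hm -hf scalerBr opprD addrACA.
rewrite !comp_mpolyX.
elim/big_ind2: _ => [|x1 x2 y1 y2 [h1 e1] [h2 e2]|v _].
- by exists 0; rewrite subrr mul0r.
- exists (h1 * y1 + x2 * h2).
  rewrite mulrDl mulrAC -e1 -mulrA -e2 mulrBl mulrBr.
  by rewrite [RHS]addrC addrA addrNK.
have [h1 e1] := hv v; elim: (m v) => [|d [h2 e2]].
  by exists 0; rewrite !expr0 subrr mul0r.
exists (h1 * tnth p v ^+ d + tnth q v * h2).
rewrite mulrDl mulrAC -e1 -mulrA -e2 mulrBl mulrBr !exprS.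
by rewrite addrA addrNK.
Qed.

Lemma exact_div_x (k : 'I_n.-1) (f : pol) :
  let d := varx (pos k) - varx (posS k) in
  exact_div (f - perm_x (simple k) f) d * d = f - perm_x (simple k) f.
Proof.
apply: exact_divK; rewrite -{1}[f]comp_mpoly_id.
apply: comp_mpoly_div => v; rewrite !tnth_mktuple.
case: (splitP v) => a ea; last first.
  exists 0; rewrite perm1 mul0r /vary.
  by have -> : v = rshift n a; [exact: val_inj | rewrite subrr].
have -> : v = lshift n a by apply: val_inj.
rewrite /varx; case: tpermP => [->|->|_ _].
- by exists 1; rewrite mul1r.
- by exists (-1); rewrite mulN1r opprB.
by exists 0; rewrite mul0r subrr.
Qed.

Lemma exact_div_y (k : 'I_n.-1) (f : pol) :
  let d := vary (pos k) - vary (posS k) in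
  exact_div (perm_x (simple k) f - perm_xy (simple k) f) d * d =
  perm_x (simple k) f - perm_xy (simple k) f.
Proof.
apply/exact_divK/comp_mpoly_div => v; rewrite !tnth_mktuple.
case: (splitP v) => a _; first by exists 0; rewrite mul0r subrr.
rewrite perm1 /vary; case: tpermP => [->|->|_ _].
- by exists 1; rewrite mul1r.
- by exists (-1); rewrite mulN1r opprB.
by exists 0; rewrite mul0r subrr.
Qed.

(* The generators determine the action, hence this structure is unique. *)
Record polynomial_representation (act : klr K D nu -> Pol -> Pol) : Prop := {
  act_linear : forall a, linear (act a);
  act_linear_l : forall f, linear (act^~ f);
  act_one : forall f, act 1 f = f;
  act_mul : forall a b f, act (a * b) f = act a (act b f);
  act_idem : forall i f,
    act (idem K D i) f = [ffun j => if j == i then f i else 0];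
  act_dot : forall k i f,
    act (dot K D k i) f = [ffun j => if j == i then varx k * f i else 0];
  act_cross : forall k i f,
    act (cross K D k i) f =
      [ffun j => if j == seq_act (simple k) i then cross_pol i k (f i) else 0]
}.

Definition faithful_action (act : klr K D nu -> Pol -> Pol) : Prop :=
  forall a, (forall f, act a f = 0) -> a = 0.

End PolynomialRepresentation.

(* Main.v *)
Require Import Defs.
From HB Require Import structures.
From mathcomp Require Import all_boot all_order all_algebra all_fingroup.
From mathcomp Require Import boolp.
From mathcomp Require Import -(notations) monalg.
From mathcomp Require Import finmap zify ring.

(** The polynomial representation does most of the work.

    Each generator acts by an explicit operator on tuples of polynomials. A
    crossing, multiplied by a denominator [x_k - x_(k+1)] or [y_k - y_(k+1)] if
    the two colours agree, is a combination of the identity, of the exchange [sx]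
    of two [x] variables, and of the exchange [sxy] of both the [x] and the [y]
    variables ([crossingE]). The defining relations thus become identities
    between such combinations, which are checked after clearing denominators;
    the braid relation for three equal colours says that both sides are the
    antisymmetrization divided by a Vandermonde product
    ([divided_difference_triple]).

    The family spans: by the relations, dots move to the right of crossings, two
    reduced words of the same permutation agree up to words with fewer crossings
    ([reduced_words_congruent]), and a nonreduced word is a combination of words
    with fewer crossings ([nonreduced_word]). Induction on the number of crossings
    leaves one word for each permutation ([filtration_spanned]).

    The family is independent already as a family of operators. Over a power of
    the discriminant of all the variables, a word of crossings expands in the
    skew group algebra of the pairs [(p, q)], where [p] permutes the [x] variables
    and [q] the [y] variables. For a reduced word of [w] the terms with [p] of
    full length have [p = w], and one of them survives: on strands of [I^+] the
    [x] variables alone are exchanged, whereas at a crossing of equal colours in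
    [I^-] the operator is a difference of [sx] and [sxy], and choosing [sxy] every
    time gives a [q] with more crossings of such strands than all other choices
    ([leading_part_crossing]). Distinct automorphisms are independent over the
    polynomials ([permute_independent]), so the polynomial coefficient of a
    longest [w] in a vanishing combination is zero ([word_crossing_independent]).

    Faithfulness comes with it: if an element acts by zero, so does each of its
    corners; expanded in the spanning family, a corner has zero coefficients. *)

Set Implicit Arguments.
Unset Strict Implicit.
Unset Printing Implicit Defensive.

Import GRing.Theory Num.Theory.

(** * Modules over a free algebra *)

Section FreeAlgebraModule.
Context (K : comNzRingType) (X : choiceType) (V : lmodType K).
Context (op : X -> V -> V) (op_linear : forall x, linear (op x)).

Local Open Scope ring_scope.

(** Any linear operators for the generators make [V] a module over the free
    algebra; the action of a presented algebra is descended from this one. *)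
Definition word_op (m : fmonom X) (v : V) : V := foldr op v (m : seq X).

Lemma word_op_linear m : linear (word_op m).
Proof.
move=> c u v; rewrite /word_op; elim: (m : seq X) => //= x s ->.
exact: op_linear.
Qed.

Definition free_act (a : free_alg K X) (v : V) : V :=
  \sum_(m <- enum_fset (msupp a)) mcoeff m a *: word_op m v.

Lemma free_act_sup (d : {fset fmonom X}) (a : free_alg K X) v :
  fsubset (msupp a) d ->
  free_act a v = \sum_(m <- enum_fset d) mcoeff m a *: word_op m v.
Proof.
move=> ad; rewrite /free_act [LHS](big_fset_incl _ ad) // => m _ /mcoeff_outdom ->.
exact: scale0r.
Qed.

Lemma free_act_linear a : linear (free_act a).
Proof.
move=> c u v; rewrite /free_act scaler_sumr -big_split /=; apply: eq_bigr => m _.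
by rewrite word_op_linear scalerDr !scalerA mulrC.
Qed.

Lemma free_act_linear_l v : linear (free_act^~ v).
Proof.
move=> c a b; set d := fsetU (msupp a) (msupp b).
have da : fsubset (msupp a) d by apply: fsubsetUl.
have db : fsubset (msupp b) d by apply: fsubsetUr.
have dab : fsubset (msupp (c *: a + b)) d.
  apply: fsubset_trans (msuppD_le _ _) _; rewrite fsubUset db andbT.
  exact: fsubset_trans (msuppZ_le _ _) da.
rewrite (free_act_sup _ da) (free_act_sup _ db) (free_act_sup _ dab).
rewrite scaler_sumr -big_split /=; apply: eq_bigr => m _.
by rewrite mcoeffD mcoeffZ scalerDl scalerA.
Qed.

Definition free_eval v : {linear free_alg K X -> V} := HB.pack (free_act^~ v)
  (GRing.isLinear.Build K (free_alg K X) V _ (free_act^~ v) (free_act_linear_l v)).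

Lemma free_actU (c : K) (m : fmonom X) v :
  free_act (mkmalgU m c) v = c *: word_op m v.
Proof.
by rewrite (free_act_sup _ (msuppU_le)) big_seq_fset1 mcoeffUU.
Qed.

Lemma free_act1 v : free_act 1 v = v.
Proof. by rewrite free_actU scale1r /word_op fm1. Qed.

Lemma free_act_gen x v : free_act (free_gen K x) v = op x v.
Proof. by rewrite free_actU scale1r /word_op fmU. Qed.

Lemma free_act_genM x a v : free_act (free_gen K x * a) v = op x (free_act a v).
Proof.
pose h : {linear V -> V} := HB.pack (op x)
  (GRing.isLinear.Build K V V _ (op x) (op_linear x)).
rewrite -[RHS]/(h (free_act a v)) -[LHS]/(free_eval v _) {1}[a]monalgE mulr_sumr.
rewrite !linear_sum; apply: eq_bigr => m _.
rewrite /= malgM_def fgmulUU free_actU mul1r /word_op fmM fmU.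
by rewrite [RHS](linearZ_LR h).
Qed.

Lemma free_alg_ind (P : free_alg K X -> Prop) :
  P 0 -> (forall a b, P a -> P b -> P (a + b)) ->
  (forall c (s : seq X), P (c *: \prod_(x <- s) free_gen K x)) -> forall a, P a.
Proof.
move=> P0 PD PM a; rewrite [a]monalgE.
elim/big_ind: _ => // m _; have := PM (mcoeff m a) (m : seq X).
suff -> : \prod_(x <- (m : seq X)) free_gen K x = mkmalgU m 1 :> free_alg K X.
  rewrite (_ : _ *: _ = mkmalgU m (mcoeff m a)) //.
  by apply/malgP => m'; rewrite mcoeffZ !mcoeffU mulr_natr.
rewrite -{2}[m]fmK; elim: (m : seq X) => [|x s IH].
  by rewrite big_nil -fmoneE.
rewrite big_cons IH malgM_def fgmulUU mul1r; congr mkmalgU.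
by apply/eqP; rewrite fmP fmM fmU.
Qed.

(** A word acts by the composite of its letters, so it suffices to peel off one
    generator at a time. *)
Lemma free_actM a b v : free_act (a * b) v = free_act a (free_act b v).
Proof.
have ev x y z : free_act (x + y) z = free_act x z + free_act y z.
  exact: (linearD (free_eval z)).
have ez k x z : free_act (k *: x) z = k *: free_act x z.
  exact: (linearZ_LR (free_eval z)).
have e0 z : free_act 0 z = 0 by exact: (linear0 (free_eval z)).
elim/free_alg_ind: a => [|a1 a2 e1 e2|c s].
- by rewrite mul0r !e0.
- by rewrite mulrDl [LHS]ev e1 e2 [in RHS]ev.
rewrite -scalerAl !ez; congr (_ *: _).
elim: s => [|x s IH]; first by rewrite big_nil mul1r free_act1.
by rewrite big_cons -mulrA !free_act_genM IH.
Qed.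

End FreeAlgebraModule.
(* Imported only now, because it reuses names of the free algebra such as
   [mcoeff] and [msupp]. *)
From mathcomp Require Import mpoly.

(** * Permutations, inversions and reduced words *)

Section Permutations.
Context (I : finType) (nu : {ffun I -> nat}).

Local Notation n := (ht nu).
Local Notation pos := (@pos I nu).
Local Notation posS := (@posS I nu).
Local Notation simple := (@simple I nu).
Implicit Types (w : 'S_n) (k l : 'I_n.-1) (ks : seq 'I_n.-1).

Local Open Scope group_scope.

Lemma pos_lt k : (pos k < posS k)%N.
Proof. exact: ltnSn. Qed.

Lemma pos_neq k : pos k != posS k.
Proof. by rewrite -val_eqE neq_ltn pos_lt. Qed.

Lemma simpleK k : simple k * simple k = 1.
Proof. exact: tperm2. Qed.

Lemma simple_pos k : simple k (pos k) = posS k.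
Proof. exact: tpermL. Qed.

Lemma simple_posS k : simple k (posS k) = pos k.
Proof. exact: tpermR. Qed.

Lemma simple_fix k a : a != pos k -> a != posS k -> simple k a = a.
Proof. by move=> ak ak'; rewrite /simple tpermD // eq_sym. Qed.

Lemma simpleV k : (simple k)^-1 = simple k.
Proof. exact: tpermV. Qed.

Lemma mul_simpleK k w : w * simple k * simple k = w.
Proof. by rewrite -mulgA simpleK mulg1. Qed.

Lemma mulV_simple k w a : (w * simple k)^-1 a = w^-1 (simple k a).
Proof. by rewrite invMg simpleV permM. Qed.

Lemma far_fix k l : (k.+1 < l)%N || (l.+1 < k)%N ->
  (simple k (pos l) = pos l) * (simple k (posS l) = posS l).
Proof. by move=> kl; split; apply: simple_fix; rewrite -val_eqE /=; lia. Qed.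

Lemma simple_comm k l : (k.+1 < l)%N || (l.+1 < k)%N ->
  simple k * simple l = simple l * simple k.
Proof.
move=> kl; rewrite [LHS]conjgC; congr (_ * _).
by rewrite {1}/simple tpermJ !far_fix // orbC.
Qed.

Lemma adj_pos k l : l = k.+1 :> nat -> pos l = posS k.
Proof. by move=> lk; apply: val_inj. Qed.

Lemma adj_simple_posS k l : l = k.+1 :> nat -> simple k (posS l) = posS l.
Proof. by move=> lk; apply: simple_fix; rewrite -val_eqE /=; lia. Qed.

Lemma adj_simple_pos k l : l = k.+1 :> nat -> simple l (pos k) = pos k.
Proof. by move=> lk; apply: simple_fix; rewrite -val_eqE /=; lia. Qed.

Lemma simple_conj k l : l = k.+1 :> nat ->
  simple k * simple l * simple k = tperm (pos k) (posS l).
Proof.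
move=> lk; transitivity (simple l ^ simple k); first by rewrite conjgE simpleV mulgA.
by rewrite tpermJ (adj_pos lk) simple_posS adj_simple_posS.
Qed.

Lemma simple_braid k l : l = k.+1 :> nat ->
  simple k * simple l * simple k = simple l * simple k * simple l.
Proof.
move=> lk; rewrite (simple_conj lk).
transitivity (simple k ^ simple l); last by rewrite conjgE simpleV mulgA.
by rewrite tpermJ adj_simple_pos // -(adj_pos lk) simple_pos.
Qed.

(** The count is relative to a set [E] of pairs so that it measures both the
    length and the number of crossings between strands of the same colour. *)
Definition inversions (E : rel 'I_n) w : nat :=
  #|[set ab : 'I_n * 'I_n |
      [&& (ab.1 < ab.2)%N, E ab.1 ab.2 & (w ab.2 < w ab.1)%N]]|.

Lemma inversions1 E : inversions E 1 = 0%N.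
Proof.
apply/eqP; rewrite cards_eq0; apply/eqP/setP => [[a b]].
by rewrite !inE !perm1 /=; case: ltngtP; rewrite ?andbF.
Qed.

(* [s_k] reverses the order of no pair of values other than [{k, k + 1}]. *)
Lemma ltn_simple k (c d : 'I_n) :
  ~~ ((c == pos k) && (d == posS k)) -> ~~ ((c == posS k) && (d == pos k)) ->
  (simple k c < simple k d)%N = (c < d)%N.
Proof.
rewrite /simple; case: tpermP => [->|->|/eqP + /eqP +];
  case: tpermP => [->|->|/eqP + /eqP +]; rewrite -!val_eqE /=; lia.
Qed.

(** Only the pair of strands that end at [k] and [k + 1] changes its order. *)
Lemma inversions_ascent E w k : (w^-1 (pos k) < w^-1 (posS k))%N ->
  inversions E (w * simple k) =
    (inversions E w + E (w^-1 (pos k)) (w^-1 (posS k)))%N.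
Proof.
set a := w^-1 (pos k); set b := w^-1 (posS k) => ab.
have wa : w a = pos k by rewrite permKV.
have wb : w b = posS k by rewrite permKV.
rewrite /inversions; set S := [set _ | _]; set T := [set _ | _].
have abT : (a, b) \notin T.
  by apply/negP; rewrite inE => /and3P[_ _] /=; rewrite wa wb /=; lia.
suff -> : S = if E a b then (a, b) |: T else T.
  by case: (E a b); rewrite ?addn0 // cardsU1 abT addnC.
apply/setP => [[c d]].
have -> : ((c, d) \in if E a b then (a, b) |: T else T) =
    ((c, d) \in T) || (E a b && ((c, d) == (a, b))).
  by case: (E a b); rewrite ?orbF // in_setU1 orbC.
rewrite !inE /= !permM.
have [/andP[/eqP -> /eqP ->]|/negP cd] := boolP ((c == a) && (d == b)).
  by rewrite wa wb simple_pos simple_posS ab eqxx pos_lt /= !andbT andbC; lia.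
have [/andP[/eqP -> /eqP ->]|dc] := boolP ((c == b) && (d == a)).
  by rewrite ltnNge (ltnW ab) /= xpair_eqE; case: eqP => [eba|]; rewrite ?andbF //;
     rewrite -eba ltnn in ab.
rewrite xpair_eqE; move/negP/negPf: (cd) => ->; rewrite andbF orbF.
rewrite ltn_simple //; first by rewrite -wa -wb !(inj_eq perm_inj) andbC.
by apply/negP; rewrite -wa -wb !(inj_eq perm_inj) andbC => /cd.
Qed.

Lemma eq_inversions (E : rel 'I_n) w w' : (forall a b, E a b -> w a = w' a /\ w b = w' b) ->
  inversions E w = inversions E w'.
Proof.
move=> ww'; congr #|pred_of_set _|; apply/setP => [[a b]]; rewrite !inE /=.
by case: (boolP (E a b)) => [/ww'[-> ->]|]; rewrite ?andbF.
Qed.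

Lemma inversions_descent E w k : (w^-1 (posS k) < w^-1 (pos k))%N ->
  inversions E w =
    (inversions E (w * simple k) + E (w^-1 (posS k)) (w^-1 (pos k)))%N.
Proof.
move=> d; rewrite -{1}[w](mul_simpleK k) inversions_ascent !mulV_simple.
  by rewrite simple_pos simple_posS.
by rewrite simple_pos simple_posS.
Qed.

Definition perm_length w := inversions (fun _ _ => true) w.

Definition descent w k := (w^-1 (posS k) < w^-1 (pos k))%N.

Lemma not_descent w k : ~~ descent w k -> (w^-1 (pos k) < w^-1 (posS k))%N.
Proof.
rewrite /descent -leqNgt leq_eqVlt => /orP[|//].
by rewrite val_eqE (inj_eq perm_inj) (negPf (pos_neq k)).
Qed.

Lemma perm_length_ascent w k : ~~ descent w k ->
  perm_length (w * simple k) = (perm_length w).+1.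
Proof. by move=> /not_descent h; rewrite /perm_length inversions_ascent // addn1. Qed.

Lemma perm_length_descent w k : descent w k ->
  perm_length w = (perm_length (w * simple k)).+1.
Proof. by move=> h; rewrite /perm_length (inversions_descent _ h) addn1. Qed.

Lemma perm_length1 : perm_length 1 = 0%N.
Proof. exact: inversions1. Qed.

Lemma perm_length_mul w k : (perm_length (w * simple k) <= (perm_length w).+1)%N.
Proof.
have [/perm_length_descent ->|/perm_length_ascent ->//] := boolP (descent w k).
by rewrite leqW.
Qed.

Lemma perm_length_word ks : (perm_length (word_perm ks) <= size ks)%N.
Proof.
elim: ks => [|k ks IH] /=; first by rewrite perm_length1.
exact: leq_trans (perm_length_mul _ _) _.
Qed.

(** An increasing permutation of [{0, .., n - 1}] dominates the identity, and so
    does its inverse. *)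
Lemma no_descent w : (forall k, ~~ descent w k) -> w = 1.
Proof.
move=> nd; have inc (a b : 'I_n) : (a < b)%N -> (w^-1 a < w^-1 b)%N.
  move: a b => [a an] [b bn] /= ab; elim: b ab bn => // b IH ab bn.
  have bn' : (b < n)%N by apply: ltn_trans bn.
  have bk : (b < n.-1)%N by lia.
  have step := not_descent (nd (Ordinal bk)).
  rewrite (_ : Ordinal bn = posS (Ordinal bk)); last exact: val_inj.
  have e : pos (Ordinal bk) = Ordinal bn' by apply: val_inj.
  move: ab; rewrite ltnS leq_eqVlt => /orP[/eqP ea|ab].
    apply: leq_trans step; rewrite e ltnS leq_eqVlt; apply/orP; left.
    by apply/eqP; congr (val (w^-1 _)); apply: val_inj.
  by apply: leq_trans step; rewrite e ltnS ltnW // IH.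
have dom (u : 'S_n) : (forall a b : 'I_n, (a < b)%N -> (u a < u b)%N) ->
    forall a : 'I_n, (a <= u a)%N.
  move=> uinc [a an]; elim: a an => // a IH an.
  have an' : (a < n)%N by apply: ltn_trans an.
  by apply: leq_ltn_trans (IH an') _; apply: uinc => /=.
have winc (a b : 'I_n) : (a < b)%N -> (w a < w b)%N.
  move=> ab; rewrite ltnNge leq_eqVlt; apply/negP => /orP[/eqP/val_inj/perm_inj e|].
    by rewrite e ltnn in ab.
  by move=> /inc; rewrite !permK ltnNge (ltnW ab).
apply/permP => a; rewrite perm1; apply/val_inj/eqP; rewrite eqn_leq dom //.
by have := dom _ inc (w a); rewrite permK => ->.
Qed.

Lemma descent_exists w : (0 < perm_length w)%N -> exists k, descent w k.
Proof.
move=> lw; have [/existsP //|/existsPn nd] := boolP [exists k, descent w k].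
by rewrite (no_descent nd) perm_length1 in lw.
Qed.

(** Sorting by adjacent transpositions removes one inversion at each descent. *)
Lemma shortest_word w :
  exists ks, word_perm ks = w /\ size ks = perm_length w.
Proof.
have [m lw] : {m | perm_length w = m} by exists (perm_length w).
elim: m w lw => [|m IH] w lw.
  exists [::]; split=> //=; rewrite (@no_descent w) // => k.
  by apply/negP => /perm_length_descent; rewrite lw.
have [k dk] : exists k, descent w k by apply: descent_exists; rewrite lw.
have [|ks [wk sk]] := IH (w * simple k).
  by have := perm_length_descent dk; rewrite lw => -[].
exists (k :: ks); split=> /=; first by rewrite wk mul_simpleK.
by rewrite sk -(perm_length_descent dk).
Qed.

Lemma reduced_expression_exists w : exists ks, reduced_expression w ks.
Proof.
have [ks [wk sk]] := shortest_word w; exists ks; split=> // ks' wk'.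
by rewrite sk -wk' perm_length_word.
Qed.

Definition reduced ks := perm_length (word_perm ks) == size ks.

Lemma reduced_expression_word w ks : reduced_expression w ks ->
  word_perm ks = w /\ reduced ks.
Proof.
move=> [wk min]; split=> //; rewrite /reduced eqn_leq perm_length_word wk /=.
by have [ks' [/min mks <-]] := shortest_word w.
Qed.

Lemma reduced_cons k ks : reduced (k :: ks) ->
  reduced ks /\ ~~ descent (word_perm ks) k.
Proof.
rewrite /reduced /= => /eqP r.
have nd : ~~ descent (word_perm ks) k.
  apply/negP => d; have := perm_length_descent d; rewrite r.
  by have := perm_length_word ks; lia.
split=> //; move: r; rewrite perm_length_ascent // => -[->]; exact: eqxx.
Qed.

Lemma reduced_consE k ks :
  reduced (k :: ks) = reduced ks && ~~ descent (word_perm ks) k.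
Proof.
apply/idP/andP => [/reduced_cons//|[/eqP r nd]].
by rewrite /reduced /= perm_length_ascent // r.
Qed.

Lemma descent_cons k ks : reduced (k :: ks) -> descent (word_perm (k :: ks)) k.
Proof.
move=> /reduced_cons[_ /not_descent h].
by rewrite /descent /= !mulV_simple simple_pos simple_posS.
Qed.

End Permutations.
(** * Permutations of the variables *)

Section VariablePermutations.
Context (K : closedFieldType) (I : finType) (nu : {ffun I -> nat}).

Local Notation n := (ht nu).
Local Notation pol := {mpoly K[n + n]}.
Local Notation permute := (@permute K I nu).
Local Notation varx := (@varx K I nu).
Local Notation vary := (@vary K I nu).
Implicit Types (p q : 'S_n) (f h : pol).

Local Open Scope ring_scope.

HB.instance Definition _ p q := GRing.RMorphism.copy (permute p q)
  (comp_mpoly [tuple match split v with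
                     | inl a => varx (p a)
                     | inr a => vary (q a)
                     end | v < n + n]).

(* These forms match on [permute] itself, where the generic morphism lemmas
   make unification unfold polynomials in search of a morphism. *)
Lemma permuteD p q : {morph permute p q : f h / f + h}.
Proof. exact: rmorphD. Qed.
Lemma permuteN p q : {morph permute p q : f / - f}.
Proof. exact: rmorphN. Qed.
Lemma permute_1 p q : permute p q 1 = 1.
Proof. exact: rmorph1. Qed.
Lemma permute_0 p q : permute p q 0 = 0.
Proof. exact: rmorph0. Qed.
Lemma permuteXn p q f m : permute p q (f ^+ m) = permute p q f ^+ m.
Proof. exact: rmorphXn. Qed.
Lemma permuteB p q : {morph permute p q : f h / f - h}.
Proof. exact: rmorphB. Qed.
Lemma permuteM p q : {morph permute p q : f h / f * h}.
Proof. exact: rmorphM. Qed.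

Lemma permuteZ p q c f : permute p q (c *: f) = c *: permute p q f.
Proof. exact: comp_mpolyZ. Qed.

Lemma permute_x p q a : permute p q (varx a) = varx (p a).
Proof.
by rewrite /permute /varx comp_mpolyXU -tnth_nth tnth_mktuple (unsplitK (inl a)).
Qed.

Lemma permute_y p q a : permute p q (vary a) = vary (q a).
Proof.
by rewrite /permute /vary comp_mpolyXU -tnth_nth tnth_mktuple (unsplitK (inr a)).
Qed.

(** A product of permutations applies its left factor first, hence the reversed
    order. *)
Lemma permute_comp p q p' q' f :
  permute p q (permute p' q' f) = permute (p' * p)%g (q' * q)%g f.
Proof.
elim/mpolyind: f => [|c m f _ _ IH]; first by rewrite !rmorph0.
rewrite !permuteD IH !permuteZ; congr (_ *: _ + _).
rewrite {2 3}/permute !comp_mpolyX rmorph_prod /=; apply: eq_bigr => v _.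
rewrite rmorphXn /= !tnth_mktuple; congr (_ ^+ _).
by case: (split v) => a; rewrite (permute_x, permute_y) permM.
Qed.

Lemma permute1 f : permute 1%g 1%g f = f.
Proof.
rewrite -[RHS]comp_mpoly_id /permute; congr comp_mpoly.
apply: eq_from_tnth => v; rewrite !tnth_mktuple.
case: splitP => a ea; rewrite perm1; congr 'X__; exact: val_inj.
Qed.

Lemma permute_inj p q : injective (permute p q).
Proof.
apply: (can_inj (g := permute p^-1%g q^-1%g)) => f.
by rewrite permute_comp !mulgV permute1.
Qed.

Lemma permute_eq0 p q f : (permute p q f == 0) = (f == 0).
Proof. by rewrite -[X in _ == X](rmorph0 (permute p q)) (inj_eq (@permute_inj p q)). Qed.

Lemma mpolyX_inj : injective (fun v : 'I_(n + n) => 'X_v : pol).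
Proof.
move=> u v /(congr1 (fun f : pol => f@_(U_(u)%MM))); rewrite !mcoeffX eqxx.
have [/(congr1 (fun m : 'X_{1..n + n} => m v))|_ /eqP] := eqVneq U_(v)%MM U_(u)%MM.
  by rewrite !mnm1E eqxx; case: eqP.
by rewrite oner_eq0.
Qed.

Lemma varx_inj : injective varx.
Proof. by move=> a b /mpolyX_inj /lshift_inj. Qed.

Lemma vary_inj : injective vary.
Proof. by move=> a b /mpolyX_inj /rshift_inj. Qed.

(** Artin's argument: from a relation, subtracting its value at [h * f] from
    the product with [permute p0 q0 h] removes one term and keeps a coefficient
    nonzero as soon as some [h] separates two of the automorphisms. *)
Lemma permute_independent (s : seq ('S_n * 'S_n)) (c : 'S_n * 'S_n -> pol) :
  uniq s -> (forall f, \sum_(g <- s) c g * permute g.1 g.2 f = 0) ->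
  forall g, g \in s -> c g = 0.
Proof.
elim: s c => [//|g0 s IH] c /= /andP[g0s us] c0.
have zs g : g \in s -> c g = 0.
  move=> gs; have [h gh] : exists h, permute g.1 g.2 h != permute g0.1 g0.2 h.
    have : g != g0 by apply: contraNneq g0s => <-.
    rewrite -pair_eqE /= negb_and => /orP[] /eqP ne.
      have [a na] : exists a, g.1 a != g0.1 a.
        apply/existsP; rewrite -negb_forall; apply/negP => /forallP e.
        by apply: ne; apply/permP => a; apply/eqP.
      by exists (varx a); rewrite !permute_x (inj_eq varx_inj).
    have [a na] : exists a, g.2 a != g0.2 a.
      apply/existsP; rewrite -negb_forall; apply/negP => /forallP e.
      by apply: ne; apply/permP => a; apply/eqP.
    by exists (vary a); rewrite !permute_y (inj_eq vary_inj).
  pose c' g := c g * (permute g.1 g.2 h - permute g0.1 g0.2 h).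
  have : c' g = 0.
    apply: IH gs => // f.
    transitivity (\sum_(g <- g0 :: s) c' g * permute g.1 g.2 f).
      by rewrite big_cons /c' subrr mulr0 mul0r add0r.
    transitivity (\sum_(g <- g0 :: s) c g * permute g.1 g.2 (h * f) -
        permute g0.1 g0.2 h * \sum_(g <- g0 :: s) c g * permute g.1 g.2 f).
      rewrite mulr_sumr -sumrB; apply: eq_bigr => g' _.
      by rewrite /c' rmorphM /=; ring.
    by rewrite !c0 mulr0 subrr.
  by move/eqP; rewrite mulf_eq0 subr_eq0 (negPf gh) orbF => /eqP.
move=> g; rewrite in_cons => /predU1P[->|/zs//].
have := c0 1; rewrite big_cons rmorph1 mulr1 big_seq big1 ?addr0 // => g' /zs ->.
by rewrite mul0r.
Qed.

End VariablePermutations.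
(** * The crossing operators *)

Section CrossingOperators.
Context (K : closedFieldType) (I : finType) (D : bc_datum I).
Context (O : orientation D) (nu : {ffun I -> nat}).

Local Notation n := (ht nu).
Local Notation pol := {mpoly K[n + n]}.
Local Notation permute := (@permute K I nu).
Local Notation varx := (@varx K I nu).
Local Notation vary := (@vary K I nu).
Local Notation sx k := (permute (simple k) 1%g).
Local Notation sxy k := (permute (simple k) (simple k)).
Implicit Types (p q w : 'S_n) (f h : pol) (a b c : I) (k l : 'I_n.-1).
Implicit Types (u v : 'I_n).

Local Open Scope ring_scope.

(** The operator of [cross_pol] depends only on the colours at the two
    positions; naming them makes the relations statements about at most three
    colours. *)
Definition crossing a b k f : pol :=
  if a == b then
    if plus_vertex D a
    then exact_div (f - perm_x (simple k) f) (varx (pos k) - varx (posS k))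
    else exact_div (perm_x (simple k) f - perm_xy (simple k) f)
           (vary (pos k) - vary (posS k))
  else if dotp D a b == 0 then perm_xy (simple k) f
  else if arrow O b a then perm_xy (simple k) f
  else (varx (pos k) ^+ expo D b a + varx (posS k) ^+ expo D a b) *
         perm_xy (simple k) f.

Definition crossing_coef a b u v : pol :=
  if dotp D a b == 0 then 1
  else if arrow O b a then 1
  else varx u ^+ expo D b a + varx v ^+ expo D a b.

Definition crossing_den a b u v : pol :=
  if a == b then if plus_vertex D a then varx u - varx v else vary u - vary v
  else 1.

Definition coef_id a b : pol := ((a == b) && plus_vertex D a)%:R.
Definition coef_x a b : pol :=
  if a == b then (if plus_vertex D a then -1 else 1) else 0.
Definition coef_xy a b u v : pol :=
  if a == b then (if plus_vertex D a then 0 else -1) else crossing_coef a b u v.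

(* Reification by [ring] and the matching of products unfold these terms
   unless they are variables. *)
Ltac atom t := let x := fresh "m" in set x := t; clearbody x.
Ltac atoms :=
  repeat match goal with
  | |- context [@Defs.permute ?K ?I ?nu ?p ?q ?f] => atom (@Defs.permute K I nu p q f)
  | |- context [crossing ?a ?b ?k ?f] => atom (crossing a b k f)
  | |- context [coef_id ?a ?b] => atom (coef_id a b)
  | |- context [coef_x ?a ?b] => atom (coef_x a b)
  | |- context [coef_xy ?a ?b ?u ?v] => atom (coef_xy a b u v)
  | |- context [crossing_coef ?a ?b ?u ?v] => atom (crossing_coef a b u v)
  | |- context [crossing_den ?a ?b ?u ?v] => atom (crossing_den a b u v)
  | |- context [@Defs.varx ?K ?I ?nu ?u] => atom (@Defs.varx K I nu u)
  | |- context [@Defs.vary ?K ?I ?nu ?u] => atom (@Defs.vary K I nu u)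
  end.

(** All cases of the definition in one formula without divisions; the relations
    below are consequences of it alone. *)
Lemma crossingE a b k f :
  crossing_den a b (pos k) (posS k) * crossing a b k f =
  coef_id a b * f + coef_x a b * sx k f + coef_xy a b (pos k) (posS k) * sxy k f.
Proof.
rewrite /crossing_den /crossing /coef_id /coef_x /coef_xy.
have [ab|ab] /= := eqVneq a b; last first.
  rewrite /crossing_coef /perm_xy.
  by do 2?[case: ifP => _]; rewrite ?mul1r !mul0r !add0r.
case: ifP => _ /=; rewrite mulrC ?exact_div_x ?exact_div_y /perm_x /perm_xy; atoms; ring.
Qed.

Lemma crossing_den_neq0 a b u v : u != v -> crossing_den a b u v != 0.
Proof.
move=> uv; rewrite /crossing_den; case: (a == b); last by rewrite oner_eq0.
by case: ifP => _; rewrite subr_eq0 ?(inj_eq (@varx_inj _ _ _))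
  ?(inj_eq (@vary_inj _ _ _)).
Qed.

Lemma crossing_den_inj a b u v : u != v -> injective ( *%R (crossing_den a b u v)).
Proof. by move=> uv; apply/mulfI/crossing_den_neq0. Qed.
Arguments crossing_den_inj a b {u v} _.

Lemma permute_coef p q a b u v :
  permute p q (crossing_coef a b u v) = crossing_coef a b (p u) (p v).
Proof.
rewrite /crossing_coef; case: (dotp D a b == 0); first exact: permute_1.
case: (arrow O b a); first exact: permute_1.
by rewrite permuteD !permuteXn !permute_x.
Qed.

Lemma permute_den w a b u v :
  permute w w (crossing_den a b u v) = crossing_den a b (w u) (w v).
Proof.
rewrite /crossing_den; do 2?[case: ifP => _]; rewrite ?permute_1 //.
  by rewrite permuteB !permute_x.
by rewrite permuteB !permute_y.
Qed.

Lemma permute_den_fix p q a b u v : p u = u -> p v = v -> q u = u -> q v = v ->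
  permute p q (crossing_den a b u v) = crossing_den a b u v.
Proof.
move=> pu pv qu qv; rewrite /crossing_den; do 2?[case: ifP => _]; rewrite ?permute_1 //.
  by rewrite permuteB !permute_x pu pv.
by rewrite permuteB !permute_y qu qv.
Qed.

Lemma permute_coef_id p q a b : permute p q (coef_id a b) = coef_id a b.
Proof. by rewrite /coef_id; case: andb; rewrite ?permute_1 ?permute_0. Qed.

Lemma permute_coef_x p q a b : permute p q (coef_x a b) = coef_x a b.
Proof.
by rewrite /coef_x; do 2?[case: ifP => _]; rewrite ?permuteN ?permute_1 ?permute_0.
Qed.

Lemma permute_coef_xy p q a b u v :
  permute p q (coef_xy a b u v) = coef_xy a b (p u) (p v).
Proof.
rewrite /coef_xy; case: (a == b); last exact: permute_coef.
by case: (plus_vertex D a); rewrite ?permuteN ?permute_1 ?permute_0.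
Qed.

Lemma crossing_neq a b k f : a != b ->
  crossing a b k f = crossing_coef a b (pos k) (posS k) * sxy k f.
Proof.
move=> ab; have := crossingE a b k f.
rewrite /crossing_den /coef_id /coef_x /coef_xy (negPf ab) /= !mul0r !add0r.
by rewrite mul1r.
Qed.

Lemma crossing_plus a k f : plus_vertex D a ->
  (varx (pos k) - varx (posS k)) * crossing a a k f = f - sx k f.
Proof.
move=> pa; have := crossingE a a k f.
rewrite /crossing_den /coef_id /coef_x /coef_xy eqxx pa /= => ->; atoms; ring.
Qed.

Lemma crossing_minus a k f : ~~ plus_vertex D a ->
  (vary (pos k) - vary (posS k)) * crossing a a k f = sx k f - sxy k f.
Proof.
move=> pa; have := crossingE a a k f.
rewrite /crossing_den /coef_id /coef_x /coef_xy eqxx (negPf pa) /= => ->; atoms; ring.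
Qed.

Local Opaque Defs.varx Defs.vary Defs.permute crossing.

(** Proves an equation as a combination of known ones: subtract a multiple of
    each until [ring] closes the goal. *)
Lemma subtract_multiple (R : pzRingType) (x y l r c : R) :
  l = r -> x - c * l = y - c * r -> x = y.
Proof. by move=> -> /addIr. Qed.

Lemma crossing_is_linear a b k : linear (crossing a b k).
Proof.
move=> c f h; apply: (crossing_den_inj a b (pos_neq k)) => /=.
have := crossingE a b k (c *: f + h); have := crossingE a b k f.
have := crossingE a b k h; rewrite !permuteD !permuteZ -!mul_mpolyC.
move: c%:MP => C; atoms => e1 e2 e3.
apply: (subtract_multiple (c := 1) e3); apply: (subtract_multiple (c := -1) e1).
apply: (subtract_multiple (c := - C) e2); ring.
Qed.

Lemma coef_id_if a b f :
  (if (a == b) && plus_vertex D a then f else 0) = coef_id a b * f.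
Proof. by rewrite /coef_id; case: ifP; rewrite ?mul1r ?mul0r. Qed.

Lemma coef_id_den a b u v : coef_id a b * crossing_den a b u v =
  coef_id a b * (varx u - varx v).
Proof.
rewrite /coef_id /crossing_den; case: eqP => _; last by rewrite !mul0r.
by case: ifP => _; rewrite ?mul0r.
Qed.

(** ** The relations *)

Lemma crossing_dot_far a b k u f : u != pos k -> u != posS k ->
  crossing a b k (varx u * f) = varx u * crossing a b k f.
Proof.
move=> uk uk'; apply: (crossing_den_inj a b (pos_neq k)) => /=.
have := crossingE a b k f; have := crossingE a b k (varx u * f).
rewrite !permuteM !permute_x simple_fix //; move: (varx u) => X; atoms => e1 e2.
apply: (subtract_multiple (c := 1) e1).
by apply: (subtract_multiple (c := - X) e2); ring.
Qed.

Lemma crossing_slide_left a b k f :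
  varx (pos k) * crossing a b k f - crossing a b k (varx (posS k) * f) =
  if (a == b) && plus_vertex D a then f else 0.
Proof.
apply: (crossing_den_inj a b (pos_neq k)) => /=.
have := crossingE a b k f; have := crossingE a b k (varx (posS k) * f).
have := coef_id_den a b (pos k) (posS k).
rewrite !permuteM !permute_x simple_posS coef_id_if.
move: (varx (pos k)) (varx (posS k)) => X Y; atoms => e0 e1 e2.
apply: (subtract_multiple (c := - f) e0); apply: (subtract_multiple (c := X) e2).
by apply: (subtract_multiple (c := -1) e1); ring.
Qed.

Lemma crossing_slide_right a b k f :
  crossing a b k (varx (pos k) * f) - varx (posS k) * crossing a b k f =
  if (a == b) && plus_vertex D a then f else 0.
Proof.
apply: (crossing_den_inj a b (pos_neq k)) => /=.
have := crossingE a b k f; have := crossingE a b k (varx (pos k) * f).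
have := coef_id_den a b (pos k) (posS k).
rewrite !permuteM !permute_x simple_pos coef_id_if.
move: (varx (pos k)) (varx (posS k)) => X Y; atoms => e0 e1 e2.
apply: (subtract_multiple (c := - f) e0); apply: (subtract_multiple (c := - Y) e2).
by apply: (subtract_multiple (c := 1) e1); ring.
Qed.

Lemma permute_crossingE p q a b k f :
  permute p q (crossing_den a b (pos k) (posS k)) * permute p q (crossing a b k f) =
  coef_id a b * permute p q f + coef_x a b * permute p q (sx k f)
  + coef_xy a b (p (pos k)) (p (posS k)) * permute p q (sxy k f).
Proof.
have := congr1 (permute p q) (crossingE a b k f).
by rewrite permuteM 2!permuteD 3!permuteM permute_coef_id permute_coef_x permute_coef_xy.
Qed.

Lemma crossing_far_expand a b c d k l f : (k.+1 < l)%N || (l.+1 < k)%N ->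
  let y1 := coef_xy a b (pos k) (posS k) in
  let y2 := coef_xy c d (pos l) (posS l) in
  crossing_den a b (pos k) (posS k) * crossing_den c d (pos l) (posS l) *
    crossing a b k (crossing c d l f) =
  coef_id a b * (coef_id c d * f + coef_x c d * sx l f + y2 * sxy l f)
  + coef_x a b * (coef_id c d * sx k f + coef_x c d * sx k (sx l f)
                  + y2 * sx k (sxy l f))
  + y1 * (coef_id c d * sxy k f + coef_x c d * sxy k (sx l f)
          + y2 * sxy k (sxy l f)).
Proof.
move=> kl; have := crossingE a b k (crossing c d l f); have := crossingE c d l f.
have := permute_crossingE (simple k) 1%g c d l f.
have := permute_crossingE (simple k) (simple k) c d l f.
rewrite permute_den permute_den_fix ?perm1 // ?(far_fix kl) //.
move: (coef_id a b) (coef_x a b) (coef_xy a b (pos k) (posS k)) => i1 x1 y1.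
move: (crossing_den c d _ _) => d2; atoms => e1 e2 e3 e4.
apply: (subtract_multiple (c := d2) e4); apply: (subtract_multiple (c := i1) e3).
apply: (subtract_multiple (c := x1) e2).
by apply: (subtract_multiple (c := y1) e1); ring.
Qed.

Lemma crossing_far a b c d k l f : (k.+1 < l)%N || (l.+1 < k)%N ->
  crossing a b k (crossing c d l f) = crossing c d l (crossing a b k f).
Proof.
move=> kl; have lk : (l.+1 < k)%N || (k.+1 < l)%N by rewrite orbC.
apply: (crossing_den_inj a b (pos_neq k)); apply: (crossing_den_inj c d (pos_neq l)).
have := crossing_far_expand a b c d f kl; have := crossing_far_expand c d a b f lk.
cbv zeta; rewrite !permute_comp !mul1g !mulg1 (simple_comm kl).
atoms => e1 e2 /=; apply: (subtract_multiple (c := 1) e2).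
by apply: (subtract_multiple (c := -1) e1); ring.
Qed.

Lemma crossing_coef_square a b u v : a != b ->
  crossing_coef b a u v * crossing_coef a b v u =
  if dotp D a b == 0 then 1 else varx u ^+ expo D a b + varx v ^+ expo D b a.
Proof.
move=> ab; rewrite /crossing_coef.
have -> : dotp D b a = dotp D a b by rewrite /dotp cartan_symmetric.
have [_|d0] := eqVneq (dotp D a b) 0; first exact: mulr1.
have := @arrow_total _ _ O a b; rewrite /adjacent ab d0 => /(_ isT).
case: (arrow O a b); case: (arrow O b a) => //= _; first by rewrite mul1r addrC.
by rewrite mulr1.
Qed.

(** For distinct colours the edge between them contributes its factor to exactly
    one of the two crossings. For equal colours a divided difference takes values
    on which the next one vanishes. *)
Lemma crossing_square a b k f :
  crossing b a k (crossing a b k f) =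
  if a == b then 0 else if dotp D a b == 0 then f
  else (varx (pos k) ^+ expo D a b + varx (posS k) ^+ expo D b a) * f.
Proof.
have [<-|ab] := eqVneq a b; last first.
  rewrite (crossing_neq k f ab) crossing_neq 1?eq_sym // permuteM permute_coef simple_pos simple_posS.
  rewrite permute_comp simpleK permute1 mulrA crossing_coef_square //.
  by case: (eqVneq (dotp D a b) 0) => _; rewrite ?mul1r.
have := crossingE a a k (crossing a a k f); set h := crossing a a k f.
rewrite /crossing_den /coef_id /coef_x /coef_xy eqxx /=; case: (boolP (plus_vertex D a)) => pa /=.
  (* A divided difference is symmetric, so a second one kills it. *)
  suff -> : sx k h = h.
    rewrite mul1r mulN1r mul0r subrr addr0 => /eqP.
    by rewrite mulf_eq0 subr_eq0 (inj_eq (@varx_inj _ _ _)) (negPf (pos_neq k)) => /eqP.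
  have hE := crossing_plus k f pa; apply: (crossing_den_inj a a (pos_neq k)).
  have := congr1 (sx k) hE; rewrite /crossing_den eqxx pa /=; move: hE.
  rewrite -/h permuteM 2!permuteB !permute_x simple_pos simple_posS.
  rewrite permute_comp simpleK mulg1 permute1; clearbody h; atoms => e1 e2.
  apply: (subtract_multiple (c := -1) e1).
  by apply: (subtract_multiple (c := -1) e2); ring.
suff -> : sx k h = sxy k h.
  rewrite mul0r mul1r mulN1r add0r subrr => /eqP.
  by rewrite mulf_eq0 subr_eq0 (inj_eq (@vary_inj _ _ _)) (negPf (pos_neq k)) => /eqP.
have hE := crossing_minus k f pa; apply: (crossing_den_inj a a (pos_neq k)).
have := congr1 (sx k) hE; have := congr1 (sxy k) hE.
rewrite /crossing_den eqxx (negPf pa) /= -/h 2!permuteM 4!permuteB !permute_y !perm1.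
rewrite simple_pos simple_posS !permute_comp simpleK !(mulg1, mul1g) permute1.
clearbody h; atoms => e1 e2; apply: (subtract_multiple (c := 1) e2).
by apply: (subtract_multiple (c := 1) e1); ring.
Qed.

(** Both nested divided differences are the antisymmetrization of [f] divided by
    the Vandermonde product [d12 * d23 * d13]. *)
Lemma divided_difference_triple (S1 T1 S2 T2 : {rmorphism pol -> pol})
    (D1 D2 : pol -> pol) (d12 d23 d13 : pol) f :
  d12 != 0 -> d12 + d23 = d13 ->
  (forall h, d12 * D1 h = S1 h - T1 h) -> (forall h, d23 * D2 h = S2 h - T2 h) ->
  S1 d12 = d12 -> S1 d13 = d13 -> S1 d23 = d23 -> S2 d12 = d12 ->
  T1 d12 = - d12 -> T1 d23 = d13 -> T1 d13 = d23 -> T2 d12 = d13 ->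
  T1 (S2 (T1 f)) = S1 (S2 (S1 f)) -> T1 (S2 (S1 f)) = S1 (S2 (T1 f)) ->
  d12 * d23 * d13 * D1 (D2 (D1 f)) =
  S1 (S2 (S1 f)) - S1 (S2 (T1 f)) - S1 (T2 (S1 f)) + S1 (T2 (T1 f))
  + T1 (T2 (S1 f)) - T1 (T2 (T1 f)).
Proof.
move=> d12n0 dD D1E D2E S1d12 S1d13 S1d23 S2d12 T1d12 T1d23 T1d13 T2d12 eA eB.
set h := D1 f; set g := D2 h.
have eS : d23 * S1 g = S1 (S2 h) - S1 (T2 h).
  by have := congr1 S1 (D2E h); rewrite rmorphM rmorphB S1d23.
have eT : d13 * T1 g = T1 (S2 h) - T1 (T2 h).
  by have := congr1 T1 (D2E h); rewrite rmorphM rmorphB T1d23.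
have hE (U V : {rmorphism pol -> pol}) :
    U (V d12) * U (V h) = U (V (S1 f)) - U (V (T1 f)).
  by rewrite -!rmorphM -!rmorphB -D1E.
have eP : d12 * S1 (S2 h) = S1 (S2 (S1 f)) - S1 (S2 (T1 f)).
  by rewrite -hE S2d12 S1d12.
have eQ : d12 * T1 (S2 h) = S1 (S2 (S1 f)) - S1 (S2 (T1 f)).
  by rewrite -eA -eB -[RHS]opprB -hE S2d12 T1d12 mulNr opprK.
have PQ : T1 (S2 h) = S1 (S2 h) by apply: (mulfI d12n0); rewrite eP eQ.
have eR : d13 * S1 (T2 h) = S1 (T2 (S1 f)) - S1 (T2 (T1 f)).
  by rewrite -hE T2d12 S1d13.
have eU : d23 * T1 (T2 h) = T1 (T2 (S1 f)) - T1 (T2 (T1 f)).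
  by rewrite -hE T2d12 T1d13.
transitivity (d23 * d13 * (d12 * D1 g)); first by atoms; ring.
rewrite D1E; transitivity (d13 * (d23 * S1 g) - d23 * (d13 * T1 g)); first by atoms; ring.
rewrite eS eT PQ.
transitivity ((d13 - d23) * S1 (S2 h) - d13 * S1 (T2 h) + d23 * T1 (T2 h)).
  by atoms; ring.
rewrite eR eU -dD addrK eP; atoms; ring.
Qed.

(** The hypotheses are symmetric in the indices 1 and 2, and so are the six terms
    of the antisymmetrization. *)
Lemma divided_difference_braid (S1 T1 S2 T2 : {rmorphism pol -> pol})
    (D1 D2 : pol -> pol) (d12 d23 d13 : pol) f :
  [/\ d12 != 0, d23 != 0, d13 != 0 & d12 + d23 = d13] ->
  (forall h, d12 * D1 h = S1 h - T1 h) -> (forall h, d23 * D2 h = S2 h - T2 h) ->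
  [/\ S1 d12 = d12, S1 d13 = d13 & S1 d23 = d23] ->
  [/\ S2 d12 = d12, S2 d13 = d13 & S2 d23 = d23] ->
  [/\ T1 d12 = - d12, T1 d13 = d23 & T1 d23 = d13] ->
  [/\ T2 d12 = d13, T2 d13 = d12 & T2 d23 = - d23] ->
  [/\ S1 (S2 (S1 f)) = S2 (S1 (S2 f)), T1 (S2 (T1 f)) = S1 (S2 (S1 f)),
      T2 (S1 (T2 f)) = S2 (S1 (S2 f)) & T1 (T2 (T1 f)) = T2 (T1 (T2 f))] ->
  [/\ T1 (S2 (S1 f)) = S1 (S2 (T1 f)), T2 (S1 (S2 f)) = S2 (S1 (T2 f)),
      S1 (S2 (T1 f)) = S2 (T1 (S2 f)) & S1 (T2 (S1 f)) = S2 (S1 (T2 f))] ->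
  S1 (T2 (T1 f)) = T2 (T1 (S2 f)) -> T1 (T2 (S1 f)) = S2 (T1 (T2 f)) ->
  D1 (D2 (D1 f)) = D2 (D1 (D2 f)).
Proof.
move=> [n12 n23 n13 dD] D1E D2E [? ? ?] [? ? ?] [? ? ?] [? ? ?] [e1 e2 e3 e4].
move=> [e5 e6 e7 e8] e9 e10; apply: (@mulfI _ (d12 * d23 * d13)).
  by rewrite !mulf_neq0.
rewrite (divided_difference_triple n12 dD D1E D2E) // [d12 * _]mulrC.
rewrite addrC in dD; rewrite (divided_difference_triple n23 dD D2E D1E) //.
rewrite e1 e4 e7 e8 e9 e10; atoms; ring.
Qed.

(** The crossing is a divided difference of the identity and [sx] in the [x]
    variables for [I^+], of [sx] and [sxy] in the [y] variables for [I^-]. *)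
Lemma crossing_braid_same a k l f : l = k.+1 :> nat ->
  crossing a a k (crossing a a l (crossing a a k f)) =
  crossing a a l (crossing a a k (crossing a a l f)).
Proof.
move=> lk; have sl := adj_pos lk.
have kS : simple k (posS l) = posS l := adj_simple_posS lk.
have lP : simple l (pos k) = pos k := adj_simple_pos lk.
have lk' : simple l (posS k) = posS l by rewrite -sl simple_pos.
have lk'' : simple l (posS l) = posS k by rewrite -sl simple_posS.
have kl3 : pos k != posS l by rewrite -val_eqE /=; lia.
have kl2 : posS k != posS l by rewrite -sl pos_neq.
have sbr := simple_braid lk.
have word p q p' q' : p = p' -> q = q' -> permute p q f = permute p' q' f.
  by move=> -> ->.
have [pa|pa] := boolP (plus_vertex D a).
  have [d [n0 dE dN dD dP]] : exists d : 'I_n -> 'I_n -> pol,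
      [/\ forall u v, u != v -> d u v != 0,
          forall p q u v, permute p q (d u v) = d (p u) (p v),
          forall u v, - d u v = d v u, forall u v v', d u v + d v v' = d u v'
        & forall m h, d (pos m) (posS m) * crossing a a m h = h - sx m h].
    exists (fun u v => varx u - varx v); split => [u v uv|p q u v|u v|u v v'|m h].
    - by rewrite subr_eq0 (inj_eq (@varx_inj _ _ _)).
    - by rewrite permuteB !permute_x.
    - exact: opprB.
    - by rewrite addrA addrNK.
    exact: crossing_plus.
  apply: (@divided_difference_braid (permute 1%g 1%g) (sx k) (permute 1%g 1%g) (sx l)
    _ _ (d (pos k) (posS k)) (d (posS k) (posS l)) (d (pos k) (posS l))).
  - by split; [exact: n0 (pos_neq k)|exact: n0|exact: n0|exact: dD].
  - by move=> h /=; rewrite permute1; exact: dP.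
  - by move=> h /=; rewrite permute1 -sl; exact: dP.
  - by split; rewrite /= dE !perm1.
  - by split; rewrite /= dE !perm1.
  - by rewrite /= !dE !dN !simple_pos !simple_posS !kS.
  - by rewrite /= !dE !dN !lk' !lk'' !lP.
  - by split; rewrite /= !permute_comp; apply: word; rewrite ?(mulg1, mul1g, simpleK) ?mulgA ?sbr.
  - by split; rewrite /= !permute_comp; apply: word; rewrite ?(mulg1, mul1g, simpleK) ?mulgA ?sbr.
  - by rewrite /= !permute_comp; apply: word; rewrite ?(mulg1, mul1g, simpleK) ?mulgA ?sbr.
  by rewrite /= !permute_comp; apply: word; rewrite ?(mulg1, mul1g, simpleK) ?mulgA ?sbr.
have [d [n0 dE dN dD dP]] : exists d : 'I_n -> 'I_n -> pol,
    [/\ forall u v, u != v -> d u v != 0,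
        forall p q u v, permute p q (d u v) = d (q u) (q v),
        forall u v, - d u v = d v u, forall u v v', d u v + d v v' = d u v'
      & forall m h, d (pos m) (posS m) * crossing a a m h = sx m h - sxy m h].
  exists (fun u v => vary u - vary v); split => [u v uv|p q u v|u v|u v v'|m h].
  - by rewrite subr_eq0 (inj_eq (@vary_inj _ _ _)).
  - by rewrite permuteB !permute_y.
  - exact: opprB.
  - by rewrite addrA addrNK.
  exact: crossing_minus.
apply: (@divided_difference_braid (sx k) (sxy k) (sx l) (sxy l)
  _ _ (d (pos k) (posS k)) (d (posS k) (posS l)) (d (pos k) (posS l))).
- by split; [exact: n0 (pos_neq k)|exact: n0|exact: n0|exact: dD].
- by move=> h /=; exact: dP.
- by move=> h /=; rewrite -sl; exact: dP.
- by split; rewrite /= dE !perm1.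
- by split; rewrite /= dE !perm1.
- by rewrite /= !dE !dN !simple_pos !simple_posS !kS.
- by rewrite /= !dE !dN !lk' !lk'' !lP.
- by split; rewrite /= !permute_comp; apply: word; rewrite ?(mulg1, mul1g, simpleK) ?mulgA ?sbr.
- by split; rewrite /= !permute_comp; apply: word; rewrite ?(mulg1, mul1g, simpleK) ?mulgA ?sbr.
- by rewrite /= !permute_comp; apply: word; rewrite ?(mulg1, mul1g, simpleK) ?mulgA ?sbr.
by rewrite /= !permute_comp; apply: word; rewrite ?(mulg1, mul1g, simpleK) ?mulgA ?sbr.
Qed.

Lemma dotpC (i j : I) : dotp D i j = dotp D j i.
Proof. exact: cartan_symmetric. Qed.

(** Away from repeated colours a crossing is a permutation of variables up to a
    factor, so it carries one divided difference to another. *)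
Lemma crossing_conjugate a w k l Q f :
  w (pos k) = pos l -> w (posS k) = posS l -> sx l Q = Q -> sxy l Q = Q ->
  crossing a a l (Q * permute w w f) = Q * permute w w (crossing a a k f).
Proof.
move=> wk wkS Qx Qxy; have cw : (simple k * w = w * simple l)%g.
  by rewrite [LHS]conjgC tpermJ wk wkS.
apply: (crossing_den_inj a a (pos_neq l)).
have := permute_crossingE w w a a k f; have := crossingE a a l (Q * permute w w f).
rewrite !permuteM Qx Qxy permute_den !permute_comp cw mul1g mulg1 wk wkS.
atoms => e1 e2 /=; apply: (subtract_multiple (c := 1) e1).
by apply: (subtract_multiple (c := - Q) e2); ring.
Qed.

Lemma conjugate_crossingE a c d u v w k f :
  permute w w (crossing_den a a (pos k) (posS k)) *
    permute w w (crossing a a k (crossing_coef c d u v * permute w w f)) =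
  coef_id a a * (crossing_coef c d (w u) (w v) * permute (w * w)%g (w * w)%g f)
  + coef_x a a * (crossing_coef c d (w (simple k u)) (w (simple k v)) *
                  permute (w * simple k * w)%g (w * w)%g f)
  + coef_xy a a (w (pos k)) (w (posS k)) *
      (crossing_coef c d (w (simple k u)) (w (simple k v)) *
       permute (w * simple k * w)%g (w * simple k * w)%g f).
Proof.
rewrite permute_crossingE; congr (_ * _ + _ * _ + _ * _).
- by rewrite permuteM permute_coef permute_comp.
- by rewrite 2!permuteM 2!permute_coef 2!permute_comp mul1g mulgA.
by rewrite 2!permuteM 2!permute_coef 2!permute_comp !mulgA.
Qed.

(** Only the identity terms of the two divided differences fail to match; their
    coefficients are two values of the same symmetric expression
    [crossing_coef_square], whose difference is divisible by the denominator. *)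
Lemma crossing_braid_sandwich a b k l f : l = k.+1 :> nat -> a != b ->
  crossing b a k (crossing a a l (crossing a b k f)) -
  crossing a b l (crossing a a k (crossing b a l f)) =
  coef_id a a * (if dotp D a b == 0 then 0 else
    \sum_(m < expo D a b)
      varx (pos k) ^+ m * varx (posS l) ^+ (expo D a b - 1 - m)) * f.
Proof.
move=> lk ab; have ba : b != a by rewrite eq_sym.
have sl := adj_pos lk.
have kS : simple k (posS l) = posS l := adj_simple_posS lk.
have lP : simple l (pos k) = pos k := adj_simple_pos lk.
have lk' : simple l (posS k) = posS l by rewrite -sl simple_pos.
have lk'' : simple l (posS l) = posS k by rewrite -sl simple_posS.
have kl3 : pos k != posS l by rewrite -val_eqE /=; lia.
apply: (crossing_den_inj a a kl3) => /=.
rewrite !(crossing_neq _ _ ba) !(crossing_neq _ _ ab) sl.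
have := conjugate_crossingE a a b (pos k) (posS k) (simple k) l f.
have := conjugate_crossingE a b a (posS k) (posS l) (simple l) k f.
rewrite !permute_den sl !(simple_pos, simple_posS, kS, lP, lk', lk'') !simpleK ?sl.
rewrite (simple_braid lk) permute1.
have := crossing_coef_square (posS k) (posS l) ba.
have := crossing_coef_square (pos k) (posS k) ab.
have := coef_id_den a a (pos k) (posS l).
rewrite [dotp D b a]dotpC.
pose s : pol := if dotp D a b == 0 then 0 else
  \sum_(m < expo D a b) varx (pos k) ^+ m * varx (posS l) ^+ (expo D a b - 1 - m).
have sE : (varx (pos k) - varx (posS l)) * s =
    if dotp D a b == 0 then 0
    else varx (pos k) ^+ expo D a b - varx (posS l) ^+ expo D a b.
  rewrite /s; case: ifP => _; first exact: mulr0.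
  rewrite -[RHS]opprB subrXX -mulNr opprB; congr (_ * _).
  by apply: eq_bigr => m _; rewrite mulrC subn1.
rewrite -/s; move: sE; clearbody s; move: (varx (pos k)) (varx (posS l)) => X Z.
move: (crossing_den a a _ _) (coef_id a a) => d A.
move: (crossing_coef b a (pos k) (posS k)) (crossing_coef a b (posS k) (posS l)).
move=> P Q; case: (dotp D a b == 0); atoms => eS eI eP eQ e1 e2;
  apply: (subtract_multiple (c := P) e2); apply: (subtract_multiple (c := - Q) e1);
  apply: (subtract_multiple (c := - (s * f)) eI);
  apply: (subtract_multiple (c := A * f) eP);
  apply: (subtract_multiple (c := - (A * f)) eQ);
  by apply: (subtract_multiple (c := - (A * f)) eS); ring.
Qed.

(** If two neighbouring colours agree and the third is different, a divided
    difference is transported along the strand of the third colour; if only the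
    outer ones agree, the transport meets an obstruction. *)
Lemma crossing_braid a b c k l f : l = k.+1 :> nat ->
  crossing b c k (crossing a c l (crossing a b k f)) -
  crossing a b l (crossing a c k (crossing b c l f)) =
  if [&& a == c, plus_vertex D a, b != a & dotp D a b != 0]
  then (\sum_(m < expo D a b)
          varx (pos k) ^+ m * varx (posS l) ^+ (expo D a b - 1 - m)) * f
  else 0.
Proof.
move=> lk; have sl := adj_pos lk.
have kS : simple k (posS l) = posS l := adj_simple_posS lk.
have lP : simple l (pos k) = pos k := adj_simple_pos lk.
have lk' : simple l (posS k) = posS l by rewrite -sl simple_pos.
have lk'' : simple l (posS l) = posS k by rewrite -sl simple_posS.
have [eab|ab] := eqVneq a b.
  subst b; rewrite !andbF; have [eac|ac] := eqVneq a c.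
    by subst c; apply/eqP; rewrite subr_eq0; apply/eqP/crossing_braid_same.
  apply/eqP; rewrite subr_eq0; apply/eqP.
  rewrite !(crossing_neq _ _ ac) sl 2!permuteM !permute_coef !permute_comp.
  rewrite simple_posS kS [LHS]mulrA [X in _ = crossing _ _ _ X]mulrA.
  by symmetry; apply: crossing_conjugate;
    rewrite ?permuteM ?permute_coef ?permM ?lP ?lk' ?lk'' ?simple_pos ?kS ?sl 1?mulrC.
have [ebc|bc] := eqVneq b c.
  subst c; rewrite (negPf ab) /=; apply/eqP; rewrite subr_eq0; apply/eqP.
  rewrite !(crossing_neq _ _ ab) sl 2!permuteM !permute_coef !permute_comp.
  rewrite lP lk' [RHS]mulrA [X in crossing _ _ _ X = _]mulrA; apply: crossing_conjugate;
    rewrite ?permuteM ?permute_coef ?permM ?sl ?simple_posS ?simple_pos ?lP ?lk'' ?kS 1?mulrC //.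
have [eac|ac] := eqVneq a c.
  subst c; rewrite crossing_braid_sandwich // /coef_id eqxx /=.
  case: (plus_vertex D a); rewrite ?mul0r // mul1r.
  by case: (dotp D a b == 0); rewrite ?mul0r.
rewrite !(crossing_neq _ _ ac) !(crossing_neq _ _ bc) !(crossing_neq _ _ ab).
apply/eqP; rewrite subr_eq0; apply/eqP; rewrite sl.
rewrite !permuteM !permute_coef !permute_comp !mulgA (simple_braid lk).
rewrite !(simple_pos, simple_posS, kS, lP, lk', lk'').
by rewrite sl; atoms; ring.
Qed.

End CrossingOperators.
(** * The polynomial representation *)

Section PolynomialAction.
Context (K : closedFieldType) (I : finType) (D : bc_datum I).
Context (O : orientation D) (nu : {ffun I -> nat}).

Local Notation n := (ht nu).
Local Notation Seq := (Seq nu).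
Local Notation pol := {mpoly K[n + n]}.
Local Notation Pol := (Pol K nu).
Local Notation F := (free_alg K (generators nu)).
Local Notation crossing := (@crossing K I D O nu).
Local Notation varx := (@varx K I nu).
Local Notation s k i := (seq_act (simple k) i).
Implicit Types (i j : Seq) (k l : 'I_n.-1) (u v : 'I_n) (f g : Pol) (a b : F).

Local Open Scope ring_scope.

Lemma entry_act (w : 'S_n) i u : entry (seq_act w i) u = entry i (w^-1%g u).
Proof. by rewrite /entry /= tnth_mktuple. Qed.

Lemma entry_inj i j : (forall u, entry i u = entry j u) -> i = j.
Proof. by move=> ij; apply/val_inj/eq_from_tnth. Qed.

Lemma seq_actM (w w' : 'S_n) i : seq_act w' (seq_act w i) = seq_act (w * w')%g i.
Proof. by apply: entry_inj => u; rewrite !entry_act invMg permM. Qed.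

Lemma seq_act1 i : seq_act 1%g i = i.
Proof. by apply: entry_inj => u; rewrite entry_act invg1 perm1. Qed.

Lemma seq_act_simpleK k i : s k (s k i) = i.
Proof. by rewrite seq_actM simpleK seq_act1. Qed.

Lemma entry_simple k i u : entry (s k i) u = entry i (simple k u).
Proof. by rewrite entry_act simpleV. Qed.

Lemma seq_act_same (u v : 'I_n) i : entry i u = entry i v -> seq_act (tperm u v) i = i.
Proof.
move=> uv; apply: entry_inj => t; rewrite entry_act tpermV.
by case: tpermP => [->|->|//].
Qed.

Lemma cross_polE i k (p : pol) :
  cross_pol O i k p = crossing (entry i (pos k)) (entry i (posS k)) k p.
Proof. by []. Qed.

Definition idem_op i f : Pol := [ffun j => if j == i then f i else 0].
Definition dot_op u f : Pol := [ffun j => varx u * f j].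

(* Sealed, because comparing the bodies for two indices is expensive. *)
Fact cross_op_exists : {T : 'I_n.-1 -> Pol -> Pol | forall k f j, T k f j =
  crossing (entry j (posS k)) (entry j (pos k)) k (f (s k j))}.
Proof.
exists (fun k f =>
  [ffun j => crossing (entry j (posS k)) (entry j (pos k)) k (f (s k j))]).
by move=> k f j; exact: ffunE.
Qed.

Definition cross_op : 'I_n.-1 -> Pol -> Pol := sval cross_op_exists.

Lemma cross_opE k f j :
  cross_op k f j = crossing (entry j (posS k)) (entry j (pos k)) k (f (s k j)).
Proof. exact: (svalP cross_op_exists). Qed.

Definition dot_at u i f : Pol := [ffun j => if j == i then varx u * f i else 0].
Definition cross_at k i f : Pol :=
  [ffun j => if j == s k i then cross_pol O i k (f i) else 0].

Definition generator_op (x : generators nu) f : Pol :=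
  match x with
  | inl (inl i) => idem_op i f
  | inl (inr (u, i)) => dot_at u i f
  | inr (k, i) => cross_at k i f
  end.

Lemma Pol_linearE c f g j : (c *: f + g) j = c *: f j + g j.
Proof. by rewrite [LHS]ffunE [X in X + _]ffunE. Qed.

Lemma generator_op_linear x : linear (generator_op x).
Proof.
have lin (b : bool) (h : pol -> pol) c p q : linear h ->
    (if b then h (c *: p + q) else 0) =
    c *: (if b then h p else 0) + (if b then h q else 0).
  by case: b => [->//|_]; rewrite scaler0 addr0.
move=> c f g; case: x => [[i|[u i]]|[k i]]; apply/ffunP => j;
  rewrite [RHS]Pol_linearE [LHS]ffunE [X in _ = _ *: X + _]ffunE
    [X in _ = _ + X]ffunE.
- rewrite Pol_linearE; exact: (lin (j == i) id).
- rewrite Pol_linearE; apply: (lin (j == i) ( *%R (varx u))) => d p q.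
  by rewrite [LHS]mulrDr -[X in X + _]scalerAr.
rewrite Pol_linearE; apply: (lin (j == s k i) (cross_pol O i k)).
exact: crossing_is_linear.
Qed.

Local Notation act := (free_act generator_op).

Definition evaluation f : {linear F -> Pol} := free_eval generator_op f.

(** The relations are checked through composites of operators: unfolding sums
    of generators inside a product is never needed. *)
Definition acts a (T : Pol -> Pol) := forall f, act a f = T f.

Lemma acts_mul a b S T : acts a S -> acts b T -> acts (a * b) (S \o T).
Proof. by move=> aS bT f; rewrite free_actM ?aS ?bT //; exact: generator_op_linear. Qed.

Lemma acts_sub a b S T : acts a S -> acts b T -> acts (a - b) (fun f => S f - T f).
Proof.
by move=> aS bT f; rewrite -aS -bT; exact: (raddfB (evaluation f)).
Qed.

Lemma acts_add a b S T : acts a S -> acts b T -> acts (a + b) (fun f => S f + T f).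
Proof.
by move=> aS bT f; rewrite -aS -bT; exact: (raddfD (evaluation f)).
Qed.

Lemma acts_0 : acts 0 (fun=> 0).
Proof. by move=> f; exact: (raddf0 (evaluation f)). Qed.

Lemma acts_1 : acts 1 id.
Proof. by move=> f; exact: free_act1. Qed.

Lemma acts_sum (T : finType) (G : T -> F) (S : T -> Pol -> Pol) :
  (forall t, acts (G t) (S t)) -> acts (\sum_t G t) (fun f => \sum_t S t f).
Proof.
move=> GS f; rewrite -[LHS]/(evaluation f _) linear_sum.
by apply: eq_bigr => t _; exact: GS.
Qed.

Lemma acts_if (c : bool) a b S T :
  acts a S -> acts b T -> acts (if c then a else b) (if c then S else T).
Proof. by case: c. Qed.

Lemma acts_idem i : acts (idem_gen K i) (idem_op i).
Proof. by move=> f; exact: free_act_gen. Qed.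

Lemma acts_dot u i : acts (dot_gen K u i) (dot_at u i).
Proof. by move=> f; exact: free_act_gen. Qed.

Lemma acts_cross k i : acts (cross_gen K k i) (cross_at k i).
Proof. by move=> f; exact: free_act_gen. Qed.

Lemma idem_opE i f j : idem_op i f j = if j == i then f i else 0.
Proof. exact: ffunE. Qed.
Lemma dot_opE u f j : dot_op u f j = varx u * f j.
Proof. exact: ffunE. Qed.
Lemma dot_atE u i f j : dot_at u i f j = if j == i then varx u * f i else 0.
Proof. exact: ffunE. Qed.
Lemma cross_atE k i f j :
  cross_at k i f j = if j == s k i then cross_pol O i k (f i) else 0.
Proof. exact: ffunE. Qed.

Lemma acts_dots u : acts (\sum_i dot_gen K u i) (dot_op u).
Proof.
move=> f; rewrite (acts_sum (acts_dot u)); apply/ffunP => j.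
rewrite sum_ffunE (bigD1 j) //= big1 ?addr0 => [|i /negPf ij].
  by rewrite dot_atE dot_opE eqxx.
by rewrite dot_atE eq_sym ij.
Qed.

Lemma acts_crosses k : acts (\sum_i cross_gen K k i) (cross_op k).
Proof.
move=> f; rewrite (acts_sum (acts_cross k)); apply/ffunP => j.
rewrite sum_ffunE (bigD1 (s k j)) //= big1 ?addr0 => [|i /negPf ij].
  rewrite cross_atE cross_opE seq_act_simpleK eqxx cross_polE !entry_simple.
  by rewrite simple_pos simple_posS.
rewrite cross_atE ifN //.
by apply: contraFN ij => /eqP ->; rewrite seq_act_simpleK.
Qed.

Definition dot_power u m f : Pol := [ffun j => varx u ^+ m * f j].

Lemma dot_powerE u m f j : dot_power u m f j = varx u ^+ m * f j.
Proof. exact: ffunE. Qed.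

Lemma acts_dotX u m : acts ((\sum_i dot_gen K u i) ^+ m) (dot_power u m).
Proof.
elim: m => [|m IH] f.
  by rewrite expr0 acts_1; apply/ffunP => j; rewrite dot_powerE mul1r.
rewrite exprSr (acts_mul IH (acts_dots u)); apply/ffunP => j.
by rewrite dot_powerE /= dot_powerE dot_opE mulrA -exprSr.
Qed.

Lemma acts_eq a b S T f : acts a S -> acts b T -> S f =1 T f -> act a f = act b f.
Proof. by move=> -> -> ST; exact/ffunP. Qed.

(** The correction terms of the slide relations are nonzero only where exchanging
    the two strands fixes the sequence, so they may be read at either end. *)
Lemma slide_value k i f j :
  (if (entry j (posS k) == entry j (pos k)) && plus_vertex D (entry j (posS k))
   then idem_op i f (s k j) else 0) =
  (if (entry i (pos k) == entry i (posS k)) && plus_vertex D (entry i (pos k))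
   then idem_op i else fun=> 0) f j.
Proof.
rewrite idem_opE; have [ji|ji] := eqVneq (s k j) i.
  have ej : j = s k i by rewrite -ji seq_act_simpleK.
  rewrite ej !entry_simple simple_pos simple_posS.
  have [ab|_] := eqVneq (entry i (pos k)) (entry i (posS k)); last by rewrite ffunE.
  rewrite (seq_act_same ab).
  by case: (plus_vertex D _); rewrite /= ?idem_opE ?eqxx ?ffunE.
rewrite if_same; case: ifP => [/andP[/eqP ab _]|_]; last by rewrite ffunE.
by rewrite idem_opE; case: eqP => // ej; rewrite ej seq_act_same // eqxx in ji.
Qed.

(** At each component a relation becomes one between the crossing operators for
    the colours at the positions concerned. *)
Lemma klr_relation_act a b f : klr_relation D a b -> act a f = act b f.
Proof.
case=> {a b}.
- move=> i j; apply: acts_eq (acts_mul (acts_idem i) (acts_idem j))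
    (acts_if (i == j) (acts_idem i) acts_0) _ => t.
  rewrite /= 2!idem_opE; have [<-|ij] := eqVneq i j; first by rewrite idem_opE.
  by rewrite ffunE; case: (t == i).
- apply: acts_eq (acts_sum acts_idem) acts_1 _ => j.
  rewrite sum_ffunE (bigD1 j) //= big1 ?addr0 => [|i /negPf ij].
    by rewrite idem_opE eqxx.
  by rewrite idem_opE eq_sym ij.
- move=> u i; apply: acts_eq
    (acts_mul (acts_mul (acts_idem i) (acts_dot u i)) (acts_idem i)) (acts_dot u i) _ => j.
  by rewrite /= idem_opE !dot_atE eqxx idem_opE eqxx.
- move=> k i; apply: acts_eq (acts_mul (acts_mul (acts_idem (s k i)) (acts_cross k i))
    (acts_idem i)) (acts_cross k i) _ => j.
  rewrite /= [LHS]idem_opE [X in if _ then X else _]cross_atE [RHS]cross_atE.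
  by rewrite (eqxx (s k i)) idem_opE (eqxx i).
- move=> u v; apply: acts_eq (acts_mul (acts_dots u) (acts_dots v))
    (acts_mul (acts_dots v) (acts_dots u)) _ => j.
  rewrite /= !dot_opE; exact: mulrCA.
- move=> k u uk uk'; apply: acts_eq (acts_mul (acts_crosses k) (acts_dots u))
    (acts_mul (acts_dots u) (acts_crosses k)) _ => j.
  rewrite /= cross_opE 2!dot_opE cross_opE; exact: crossing_dot_far.
- move=> k l kl; apply: acts_eq (acts_mul (acts_crosses k) (acts_crosses l))
    (acts_mul (acts_crosses l) (acts_crosses k)) _ => j.
  have lk : (l.+1 < k)%N || (k.+1 < l)%N by rewrite orbC.
  rewrite /= !cross_opE !entry_simple !(far_fix kl) !(far_fix lk) !seq_actM.
  rewrite (simple_comm kl).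
  exact: crossing_far.
- move=> k i a b; apply: acts_eq (acts_mul (acts_mul (acts_crosses k) (acts_crosses k))
    (acts_idem i)) (acts_if (a == b) acts_0 (acts_if (dotp D a b == 0) (acts_idem i)
      (acts_mul (acts_add (acts_dotX (pos k) _) (acts_dotX (posS k) _))
        (acts_idem i)))) _ => j.
  rewrite /= !cross_opE !entry_simple simple_pos simple_posS seq_act_simpleK.
  rewrite crossing_square idem_opE -/a -/b.
  have [ji|ji] := eqVneq j i.
    rewrite {}ji -/a -/b; case: (a == b); first by rewrite ffunE.
    case: (dotp D a b == 0); first by rewrite idem_opE eqxx.
    by rewrite /= ffunE !dot_powerE idem_opE eqxx mulrDl.
  rewrite !mulr0 !if_same; case: (a == b); first by rewrite ffunE.
  case: (dotp D a b == 0); first by rewrite idem_opE (negPf ji).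
  by rewrite /= ffunE !dot_powerE idem_opE (negPf ji) !mulr0 addr0.
- move=> k i a b; apply: acts_eq (acts_mul (acts_sub
    (acts_mul (acts_dots (pos k)) (acts_crosses k))
    (acts_mul (acts_crosses k) (acts_dots (posS k)))) (acts_idem i))
    (acts_if _ (acts_idem i) acts_0) _ => j.
  rewrite [LHS]ffunE [X in _ + X]ffunE /= dot_opE !cross_opE dot_opE.
  rewrite crossing_slide_left; exact: slide_value.
- move=> k i a b; apply: acts_eq (acts_mul (acts_sub
    (acts_mul (acts_crosses k) (acts_dots (pos k)))
    (acts_mul (acts_dots (posS k)) (acts_crosses k))) (acts_idem i))
    (acts_if _ (acts_idem i) acts_0) _ => j.
  rewrite [LHS]ffunE [X in _ + X]ffunE /= dot_opE !cross_opE dot_opE.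
  rewrite crossing_slide_right; exact: slide_value.
move=> k l i lk a b c; apply: acts_eq (acts_mul (acts_sub
  (acts_mul (acts_mul (acts_crosses k) (acts_crosses l)) (acts_crosses k))
  (acts_mul (acts_mul (acts_crosses l) (acts_crosses k)) (acts_crosses l)))
  (acts_idem i))
  (acts_if _ (acts_sum (fun m : 'I_(expo D a b) => acts_mul (acts_mul (acts_dotX (pos k) m)
     (acts_dotX (posS l) (expo D a b - 1 - m))) (acts_idem i))) acts_0) _ => j.
have sl := adj_pos lk.
have kS : simple k (posS l) = posS l := adj_simple_posS lk.
have lP : simple l (pos k) = pos k := adj_simple_pos lk.
have lk' : simple l (posS k) = posS l by rewrite -sl simple_pos.
have lk'' : simple l (posS l) = posS k by rewrite -sl simple_posS.
rewrite [LHS]ffunE [X in _ + X]ffunE /= !cross_opE !entry_simple.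
rewrite !(simple_pos, simple_posS, kS, lP, lk', lk'', sl) !seq_actM !mulgA.
rewrite -(simple_braid lk) crossing_braid // (simple_conj lk) [RHS](_ : _ =
    if [&& a == c, plus_vertex D a, b != a & dotp D a b != 0]
    then (\sum_(m < expo D a b)
      varx (pos k) ^+ m * varx (posS l) ^+ (expo D a b - 1 - m)) * idem_op i f j
    else 0); last first.
  case: [&& _, _, _ & _]; last by rewrite ffunE.
  rewrite sum_ffunE mulr_suml; apply: eq_bigr => m _.
  by rewrite 2!dot_powerE mulrA.
have sbE : b = entry i (posS k) by rewrite /b sl.
rewrite 2!idem_opE; have [ji|ji] := eqVneq (seq_act (tperm (pos k) (posS l)) j) i.
  have ej : j = seq_act (tperm (pos k) (posS l)) i.
    by rewrite -ji seq_actM tperm2 seq_act1.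
  have entE u : entry j u = entry i (tperm (pos k) (posS l) u).
    by rewrite ej entry_act tpermV.
  rewrite !entE tpermL tpermR tpermD ?pos_neq -?sl 1?eq_sym ?pos_neq //.
  rewrite -/a -/b -/c; have [ac|//] := eqVneq a c.
  by rewrite {1}ej (seq_act_same ac) eqxx.
rewrite mulr0 if_same; case: ifP => // /andP[/eqP ac _].
by case: eqP => [ej|]; rewrite ?mulr0 //; rewrite ej (seq_act_same ac) eqxx in ji.
Qed.

Lemma relation_ideal_act a f : relation_ideal (@klr_relation K I D nu) a -> act a f = 0.
Proof.
elim=> [|b b' u v w uv _ IH]; first exact: acts_0.
have M x y g : act (x * y) g = act x (act y g).
  exact: free_actM generator_op_linear x y g.
have D' x y g : act (x + y) g = act x g + act y g.
  exact: (raddfD (evaluation g)).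
have B x y g : act (x - y) g = act x g - act y g.
  exact: (raddfB (evaluation g)).
rewrite D' IH addr0 2!M B (klr_relation_act _ uv) subrr.
by rewrite -[X in act b X](acts_0 0) -M mulr0; exact: acts_0.
Qed.

Definition klr_act (x : klr K D nu) f : Pol := act (projT1 (presented_repr x)) f.

Lemma klr_act_pi a f : klr_act (presented_pi _ a) f = act a f.
Proof.
rewrite /klr_act; case: presented_repr => b /= /presented_piP ab.
apply/eqP; rewrite -subr_eq0 -[_ - _]opprB oppr_eq0 -(raddfB (evaluation f)) /=.
exact/eqP/relation_ideal_act.
Qed.

Lemma klr_act_representation : polynomial_representation O klr_act.
Proof.
have lift (x : klr K D nu) : exists a, x = presented_pi (@klr_relation K I D nu) a.
  by have [a ->] := presented_repr x; exists a.
split.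
- by move=> x; exact: free_act_linear generator_op_linear _.
- move=> f c x y; have [a ->] := lift x; have [b ->] := lift y.
  rewrite -presented_piZ -presented_piD !klr_act_pi.
  exact: (linearP (evaluation f)).
- by move=> f; rewrite klr_act_pi; exact: acts_1.
- move=> x y f; have [a ->] := lift x; have [b ->] := lift y.
  rewrite -presented_piM !klr_act_pi; exact: free_actM generator_op_linear a b f.
- by move=> i f; rewrite klr_act_pi; exact: acts_idem.
- by move=> u i f; rewrite klr_act_pi; exact: acts_dot.
by move=> k i f; rewrite klr_act_pi; exact: acts_cross.
Qed.

End PolynomialAction.
(** * Leading terms of words of crossings *)

Section LeadingTerms.
Context (K : closedFieldType) (I : finType) (D : bc_datum I).
Context (O : orientation D) (nu : {ffun I -> nat}).

Local Notation n := (ht nu).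
Local Notation Seq := (Seq nu).
Local Notation pol := {mpoly K[n + n]}.
Local Notation permute := (@permute K I nu).
Local Notation varx := (@varx K I nu).
Local Notation vary := (@vary K I nu).
Local Notation crossing := (@crossing K I D O nu).
Local Notation crossing_coef := (@crossing_coef K I D O nu).
Local Notation crossing_den := (@crossing_den K I D nu).
Local Notation sx k := (permute (simple k) 1%g).
Local Notation sxy k := (permute (simple k) (simple k)).
Implicit Types (p q w : 'S_n) (f h : pol) (a b : I) (k : 'I_n.-1).
Implicit Types (u v : 'I_n) (i : Seq) (ks : seq 'I_n.-1).

Local Open Scope ring_scope.

Definition discriminant_of (z : 'I_n -> pol) : pol :=
  \prod_(uv : 'I_n * 'I_n | uv.1 != uv.2) (z uv.1 - z uv.2).

(** Running over ordered pairs makes this product invariant, without signs. *)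
Definition discriminant : pol := discriminant_of varx * discriminant_of vary.

Lemma permute_discriminant_of p q w (z : 'I_n -> pol) :
  (forall u, permute p q (z u) = z (w u)) ->
  permute p q (discriminant_of z) = discriminant_of z.
Proof.
move=> zw; rewrite rmorph_prod /= [RHS](reindex (fun uv => (w uv.1, w uv.2))) /=.
  apply: eq_big => uv; first by rewrite (inj_eq perm_inj).
  by rewrite permuteB !zw.
by exists (fun uv => (w^-1%g uv.1, w^-1%g uv.2)) => [] [u v] _ /=;
  rewrite ?permK ?permKV.
Qed.

Lemma permute_discriminant p q : permute p q discriminant = discriminant.
Proof.
rewrite permuteM (@permute_discriminant_of p q p); last exact: permute_x.
by rewrite (@permute_discriminant_of p q q) //; exact: permute_y.
Qed.

Lemma discriminant_of_neq0 (z : 'I_n -> pol) : injective z -> discriminant_of z != 0.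
Proof. by move=> zi; apply/prodf_neq0 => uv ne; rewrite subr_eq0 (inj_eq zi). Qed.

Lemma discriminant_neq0 : discriminant != 0.
Proof.
rewrite mulf_neq0 ?discriminant_of_neq0 //; [exact: varx_inj|exact: vary_inj].
Qed.

Lemma discriminant_den a b u v : u != v ->
  exists2 d, d != 0 & discriminant = d * crossing_den a b u v.
Proof.
move=> uv; have [d dE] : exists d, discriminant = d * crossing_den a b u v.
  have factor z : exists d, discriminant_of z = d * (z u - z v).
    by rewrite /discriminant_of (bigD1 (u, v)) //= mulrC; eexists.
  rewrite /crossing_den /discriminant; case: (a == b); last first.
    by exists discriminant; rewrite mulr1.
  have [[dx ->] [dy ->]] := (factor varx, factor vary); case: (plus_vertex D a).
    by exists (dx * (dy * (vary u - vary v))); ring.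
  by exists (dx * (varx u - varx v) * dy); ring.
exists d => //; apply: contraNneq discriminant_neq0 => d0.
by rewrite dE d0 mul0r.
Qed.

Lemma expo_gt0 a b : dotp D a b != 0 -> (0 < expo D a b)%N.
Proof.
rewrite /dotp /expo absz_gt0; by apply: contraNneq => ->; rewrite mulr0.
Qed.

Lemma crossing_coef_neq0 a b u v : u != v -> crossing_coef a b u v != 0.
Proof.
move=> uv; rewrite /crossing_coef; have [_|d0] := eqVneq (dotp D a b) 0.
  by rewrite oner_eq0.
case: (arrow O b a); first by rewrite oner_eq0.
have e0 : (0 < expo D b a)%N by apply: expo_gt0; rewrite dotpC.
(* No cancellation at the pure power of the first variable. *)
apply/eqP => /(congr1 (fun g : pol => g@_(U_(lshift n u) *+ expo D b a))).
rewrite /Defs.varx !mpolyXn mcoeffD !mcoeffX eqxx mcoeff0.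
have [/(congr1 (fun m : 'X_{1..n + n} => m (lshift n u)))|_] := eqVneq.
  rewrite !mulmnE !mnm1E eqxx eq_lshift eq_sym (negPf uv) mul0n mul1n => e.
  by rewrite -e in e0.
by move/eqP; rewrite addr0 oner_eq0.
Qed.

(** Over the common denominator, a crossing is the identity, [sx] or [sxy] with
    coefficients whose vanishing depends only on the colours. *)
Lemma crossing_terms a b k : exists al be ga,
  [/\ forall f, discriminant * crossing a b k f = al * f + be * sx k f + ga * sxy k f,
      (be != 0) = (a == b) & (ga != 0) = ~~ ((a == b) && plus_vertex D a)].
Proof.
have [d d0 dE] := discriminant_den a b (pos_neq k).
exists (d * @coef_id K I D nu a b), (d * @coef_x K I D nu a b).
exists (d * @coef_xy K I D O nu a b (pos k) (posS k)); split.
- by move=> f; rewrite dE -[LHS]mulrA crossingE 2!mulrDr !(mulrA d).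
- rewrite mulf_eq0 (negPf d0) /coef_x; case: (a == b); last by rewrite eqxx.
  by case: (plus_vertex D a); rewrite ?oppr_eq0 oner_eq0.
rewrite mulf_eq0 (negPf d0) /coef_xy; case: (a == b) => /=.
  by case: (plus_vertex D a); rewrite ?eqxx // oppr_eq0 oner_eq0.
exact: crossing_coef_neq0 (pos_neq k).
Qed.

Local Notation coefs := ('S_n * 'S_n -> pol).

(** [c] are the coefficients of the operator [T] in the skew group algebra of
    the permutations of variables, over the denominator [discriminant ^+ r]. *)
Definition expands r (T : pol -> pol) (c : coefs) := forall f,
  discriminant ^+ r * T f = \sum_g c g * permute g.1 g.2 f.

Definition crossing_coefs (al be ga : pol) k (c : coefs) : coefs := fun g =>
  al * c g + be * sx k (c (g.1 * simple k, g.2)%g)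
  + ga * sxy k (c (g.1 * simple k, g.2 * simple k)%g).

Lemma permute_expansion w q r T c f : expands r T c ->
  discriminant ^+ r * permute w q (T f) =
  \sum_g permute w q (c (g.1 * w^-1, g.2 * q^-1)%g) * permute g.1 g.2 f.
Proof.
move=> Tc; rewrite -{1}(permute_discriminant w q) -permuteXn -permuteM Tc.
rewrite rmorph_sum /= [RHS](reindex (fun g => (g.1 * w, g.2 * q)%g)) /=.
  by apply: eq_bigr => g _; rewrite !mulgK permuteM permute_comp -surjective_pairing.
by exists (fun g => (g.1 * w^-1, g.2 * q^-1)%g) => [] [x y] _ /=;
  rewrite ?mulgK ?mulgKV.
Qed.

Lemma expands_crossing a b k r T c al be ga :
  (forall f, discriminant * crossing a b k f =
    al * f + be * sx k f + ga * sxy k f) ->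
  expands r T c -> expands r.+1 (crossing a b k \o T) (crossing_coefs al be ga k c).
Proof.
move=> cE Tc f; rewrite exprSr -mulrA /= cE 2!mulrDr.
rewrite [X in X + _ + _]mulrCA [X in _ + X + _]mulrCA [X in _ + X]mulrCA.
rewrite !(permute_expansion _ _ _ Tc) Tc.
rewrite [RHS](eq_bigr (fun g => al * (c g * permute g.1 g.2 f)
  + be * (sx k (c (g.1 * simple k, g.2)%g) * permute g.1 g.2 f)
  + ga * (sxy k (c (g.1 * simple k, g.2 * simple k)%g) * permute g.1 g.2 f))).
  rewrite 2!big_split /= simpleV invg1; congr (_ + _ + _);
    rewrite [LHS]mulr_sumr; apply: eq_bigr => g _ //.
  by rewrite mulg1.
by move=> g _; rewrite /crossing_coefs 2!mulrDl -!mulrA.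
Qed.

Lemma crossing_coefs_neq0 al be ga k c p q :
  crossing_coefs al be ga k c (p, q) != 0 ->
  [|| c (p, q) != 0, (be != 0) && (c (p * simple k, q)%g != 0)
    | (ga != 0) && (c (p * simple k, q * simple k)%g != 0)].
Proof.
apply: contraNT; rewrite !negb_or !negb_and !negbK => /and3P[/eqP c0 h1 h2].
rewrite /crossing_coefs c0 mulr0 add0r.
have -> : be * sx k (c (p * simple k, q)%g) = 0.
  by case/orP: h1 => /eqP ->; rewrite ?permute_0 ?mulr0 ?mul0r.
by rewrite add0r; case/orP: h2 => /eqP ->; rewrite ?permute_0 ?mulr0 ?mul0r.
Qed.

Fixpoint word_crossing i ks f : pol :=
  if ks is k :: ks' then
    cross_pol O (seq_act (word_perm ks') i) k (word_crossing i ks' f)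
  else f.

(** Pairs of strands of the same colour in [I^-]: only at their crossings does
    the operator mix several permutations of the [y] variables. *)
Definition minus_pair i : rel 'I_n :=
  fun u v => (entry i u == entry i v) && ~~ plus_vertex D (entry i u).

(** The coefficients at [(p, q)] with [p] of full length form the leading part.
    Among its terms, the [q0] in which all strands of [I^-] cross has the most
    crossings of such strands, so nothing cancels its coefficient. *)
Definition leading_part i w r (c : coefs) :=
  [/\ forall p q, c (p, q) != 0 -> p = w \/ (perm_length p < r)%N,
      forall q, c (w, q) != 0 -> seq_act q i = seq_act w i /\
        (inversions (minus_pair i) q <= inversions (minus_pair i) w)%N
    & exists2 q0, c (w, q0) != 0 &
        forall u, ~~ plus_vertex D (entry i u) -> q0 u = w u].

Lemma leading_part1 i : leading_part i 1%g 0 (fun g => (g == (1, 1)%g)%:R).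
Proof.
split=> [p q|q|].
- by rewrite xpair_eqE; case: (eqVneq p 1%g) => [->|_]; [left|rewrite eqxx].
- by rewrite xpair_eqE eqxx /=; case: (eqVneq q 1%g) => [->|_]; rewrite ?eqxx.
by exists 1%g; rewrite // eqxx oner_eq0.
Qed.

(** Among the three terms of a crossing only [sx] and [sxy] lengthen [w]. *)
Lemma leading_part_crossing i w r c k al be ga :
  let a := entry (seq_act w i) (pos k) in
  let b := entry (seq_act w i) (posS k) in
  perm_length w = r -> ~~ descent w k ->
  (be != 0) = (a == b) -> (ga != 0) = ~~ ((a == b) && plus_vertex D a) ->
  leading_part i w r c ->
  leading_part i (w * simple k)%g r.+1 (crossing_coefs al be ga k c).
Proof.
move=> a b lw nd be0 ga0 [c1 c2 [q0 cq0 q0w]].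
set w' := (w * simple k)%g; set m := inversions (minus_pair i).
have lw' : perm_length w' = r.+1 by rewrite perm_length_ascent ?lw.
have lt_uv := not_descent nd; set u := w^-1%g _ in lt_uv; set v := w^-1%g _ in lt_uv.
have wu : w u = pos k by rewrite permKV.
have wv : w v = posS k by rewrite permKV.
have au : a = entry i u by rewrite /a entry_act.
have bv : b = entry i v by rewrite /b entry_act.
have cw0 q : c (w', q) = 0.
  apply/eqP; apply: contraT => /c1[e|]; last by rewrite lw'; lia.
  by have := lw'; rewrite e lw; lia.
have mw' : m w' = (m w + minus_pair i u v)%N by apply: inversions_ascent.
have col q p : seq_act q i = seq_act p i -> forall t, entry i (q^-1%g t) = entry i (p^-1%g t).
  by move=> e t; rewrite -!entry_act e.
have c'w' q : crossing_coefs al be ga k c (w', q) =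
    be * sx k (c (w, q)) + ga * sxy k (c (w, q * simple k)%g).
  by rewrite /crossing_coefs cw0 mulr0 add0r /w' mul_simpleK.
have mul_minus q : seq_act q i = seq_act w i ->
    (m (q * simple k)%g <= m q + minus_pair i u v)%N.
  move=> qw; have [d|nd'] := boolP (descent q k).
    by rewrite /m (inversions_descent _ d); lia.
  rewrite /m inversions_ascent; last exact: not_descent.
  by rewrite /minus_pair !(col _ _ qw).
split.
- move=> p q /crossing_coefs_neq0 /or3P[/c1[->|]|/andP[_ /c1 h]|/andP[_ /c1 h]].
  + by right; rewrite lw.
  + by move=> h; right; lia.
  + case: h => [e|h]; [by left; rewrite /w' -e mul_simpleK|right].
    by rewrite -(mul_simpleK k p); apply: leq_ltn_trans (perm_length_mul _ _) _.
  case: h => [e|h]; [by left; rewrite /w' -e mul_simpleK|right].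
  by rewrite -(mul_simpleK k p); apply: leq_ltn_trans (perm_length_mul _ _) _.
- move=> q; rewrite /w' => /crossing_coefs_neq0; rewrite -/w' cw0 eqxx /=.
  rewrite mul_simpleK be0 ga0 => /orP[/andP[/eqP ab]|/andP[_]] /c2[qw mq].
    rewrite qw -seq_actM seq_act_same -/a -/b //; split=> //.
    by rewrite -/m mw'; apply: leq_trans mq _; rewrite leq_addr.
  rewrite -(mul_simpleK k q) -seq_actM qw seq_actM; split=> //.
  by apply: leq_trans (mul_minus _ qw) _; rewrite -/m mw' leq_add2r.
have q0i : seq_act q0 i = seq_act w i by case: (c2 _ cq0).
(* Distinct colours: only [sxy] occurs. *)
have [ab|ab] := boolP (a == b); last first.
  exists (q0 * simple k)%g; last by move=> t tm; rewrite !permM q0w.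
  rewrite c'w' mul_simpleK.
  have -> : be = 0 by apply/eqP; rewrite -[_ == _]negbK be0.
  by rewrite mul0r add0r mulf_neq0 ?permute_eq0 // ga0 (negPf ab).
(* Equal colours in [I^+]: only [sx] occurs. *)
have [pa|pa] := boolP (plus_vertex D a).
  exists q0.
    rewrite c'w'; have -> : ga = 0 by apply/eqP; rewrite -[_ == _]negbK ga0 ab pa.
    by rewrite mul0r addr0 mulf_neq0 ?permute_eq0 // be0.
  move=> t tm; rewrite q0w // permM simple_fix //.
    by apply: contraNneq tm => tk; rewrite -[t](permK w) tk -/u -au.
  by apply: contraNneq tm => tk; rewrite -[t](permK w) tk -/v -bv -(eqP ab).
(* Equal colours in [I^-]: both occur, but the [sx] term would come from
   [q0 * simple k], which has too many crossings of strands in [I^-]. *)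
exists (q0 * simple k)%g; last by move=> t tm; rewrite !permM q0w.
have euv : minus_pair i u v by rewrite /minus_pair -au -bv ab pa.
have q0u : q0 u = pos k by rewrite q0w ?wu // -au.
have q0v : q0 v = posS k by rewrite q0w ?wv // -bv -(eqP ab).
rewrite c'w' mul_simpleK; have -> : c (w, q0 * simple k)%g = 0.
  apply/eqP; apply: contraT => /c2[_]; rewrite -/m.
  have -> : m w = m q0.
    apply: eq_inversions => s t /andP[/eqP st sm].
    by rewrite !q0w // -st.
  rewrite {1}/m inversions_ascent.
    by rewrite -q0u -q0v !permK euv /m; lia.
  by rewrite -q0u -q0v !permK.
by rewrite permute_0 mulr0 add0r mulf_neq0 ?permute_eq0 // ga0 ab pa.
Qed.

Lemma word_expansion i ks : reduced ks ->
  exists2 c, expands (size ks) (word_crossing i ks) c &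
    leading_part i (word_perm ks) (size ks) c.
Proof.
elim: ks => [_|k ks IH /reduced_cons[rks nd]].
  exists (fun g => (g == (1, 1)%g)%:R); last exact: leading_part1.
  move=> f; rewrite expr0 mul1r (bigD1 (1, 1)%g) //= eqxx mul1r permute1 big1 ?addr0 //.
  by move=> g /negPf ->; rewrite mul0r.
have [c ce cl] := IH rks.
have [al [be [ga [E be0 ga0]]]] := crossing_terms
  (entry (seq_act (word_perm ks) i) (pos k)) (entry (seq_act (word_perm ks) i) (posS k)) k.
exists (crossing_coefs al be ga k c); first exact: expands_crossing E ce.
apply: leading_part_crossing => //; exact/eqP.
Qed.

End LeadingTerms.
(** * Linear independence *)

Section Independence.
Context (K : closedFieldType) (I : finType) (D : bc_datum I).
Context (O : orientation D) (nu : {ffun I -> nat}).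

Local Notation n := (ht nu).
Local Notation Seq := (Seq nu).
Local Notation pol := {mpoly K[n + n]}.
Local Notation Pol := (Pol K nu).
Local Notation permute := (@permute K I nu).
Local Notation word_crossing := (@word_crossing K I D O nu).
Local Notation varx := (@varx K I nu).
Local Notation exponents := {ffun 'I_n -> nat}.
Implicit Types (i j : Seq) (k : 'I_n.-1) (u : 'I_n) (ks : seq 'I_n.-1).
Implicit Types (m : exponents) (f : pol) (g : Pol).

Local Open Scope ring_scope.

Definition x_monomial m : pol := \prod_(u < n) varx u ^+ m u.

Definition x_exponent m : 'X_{1..n + n} :=
  [multinom (match split v with inl u => m u | inr _ => 0%N end) | v < n + n].

Lemma x_monomialE m : x_monomial m = 'X_[x_exponent m].
Proof.
rewrite mpolyXE_id big_split_ord /= [X in _ * X]big1 ?mulr1 => [|u _].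
  by apply: eq_bigr => u _; rewrite mnmE (unsplitK (inl u)).
by rewrite mnmE (unsplitK (inr u)) expr0.
Qed.

Lemma x_exponent_inj : injective x_exponent.
Proof.
move=> m m' e; apply/ffunP => u.
have := congr1 (fun mm : 'X_{1..n + n} => mm (lshift n u)) e.
by rewrite !mnmE (unsplitK (inl u)).
Qed.

Section Representation.
Context (act : klr K D nu -> Pol -> Pol) (rep : polynomial_representation O act).

Lemma act_linear_sum (T : Type) (r : seq T) (a : T -> klr K D nu) g :
  act (\sum_(t <- r) a t) g = \sum_(t <- r) act (a t) g.
Proof.
pose h : {linear klr K D nu -> Pol} := HB.pack (act^~ g)
  (GRing.isLinear.Build K (klr K D nu) Pol _ (act^~ g) (act_linear_l rep g)).
exact: (raddf_sum h).
Qed.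

Lemma act_linearZ c a g : act (c *: a) g = c *: act a g.
Proof.
pose h : {linear klr K D nu -> Pol} := HB.pack (act^~ g)
  (GRing.isLinear.Build K (klr K D nu) Pol _ (act^~ g) (act_linear_l rep g)).
exact: (linearZ_LR h).
Qed.

Lemma act_0 g : act 0 g = 0.
Proof. by rewrite -[0](scale0r 0) act_linearZ scale0r. Qed.

Lemma act_on_0 a : act a 0 = 0.
Proof.
pose h : {linear Pol -> Pol} := HB.pack (act a)
  (GRing.isLinear.Build K Pol Pol _ (act a) (act_linear rep a)).
exact: (linear0 h).
Qed.

Definition single i f : Pol := [ffun j => if j == i then f else 0].

Lemma singleE i f : single i f i = f.
Proof. by rewrite ffunE eqxx. Qed.

Lemma act_idem_single i g : act (idem K D i) g = single i (g i).
Proof. exact: act_idem rep i g. Qed.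

Lemma act_cross_sum k i f :
  act (\sum_j cross K D k j) (single i f) = single (seq_act (simple k) i) (cross_pol O i k f).
Proof.
rewrite act_linear_sum (bigD1 i) //= big1 ?addr0 => [|j /negPf ji].
  by rewrite (act_cross rep) singleE.
rewrite (act_cross rep) /single [X in cross_pol _ _ _ X]ffunE ji.
apply/ffunP => t; rewrite [LHS]ffunE [RHS]ffunE; case: ifP => // _.
rewrite cross_polE.
pose h : {linear pol -> pol} := HB.pack (crossing O (entry j (pos k)) (entry j (posS k)) k)
  (GRing.isLinear.Build K pol pol _ _ (crossing_is_linear O (entry j (pos k)) (entry j (posS k)) k)).
exact: (linear0 h).
Qed.

Lemma act_cross_word ks i g :
  act (cross_word K D ks i) g =
  single (seq_act (word_perm ks) i) (word_crossing i ks (g i)).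
Proof.
rewrite /cross_word (act_mul rep) act_idem_single.
elim: ks => [|k ks IH].
  by rewrite big_nil (act_one rep) /= seq_act1.
by rewrite big_cons (act_mul rep) IH act_cross_sum seq_actM.
Qed.

Lemma act_dots_at i m g :
  act (\prod_(u < n) dot K D u i ^+ m u) g i = x_monomial m * g i.
Proof.
rewrite /x_monomial; elim: (index_enum _) => [|u r IH].
  by rewrite !big_nil (act_one rep) mul1r.
rewrite !big_cons (act_mul rep) -mulrA -IH.
move: (act (\prod_(j <- r) _) g) => h.
elim: (m u) => [|e IHe]; first by rewrite !expr0 (act_one rep) mul1r.
rewrite !exprS (act_mul rep) (act_dot rep) ffunE eqxx IHe; exact: mulrA.
Qed.

Lemma act_basis_element i ks m g :
  act (basis_element K D i ks m) g =
  single (seq_act (word_perm ks) i) (word_crossing i ks (x_monomial m * g i)).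
Proof. by rewrite /basis_element (act_mul rep) act_cross_word act_dots_at. Qed.

End Representation.

Lemma word_crossing_is_linear i ks : linear (word_crossing i ks).
Proof.
elim: ks => [|k ks IH] c f f' //=.
by rewrite IH; exact: crossing_is_linear.
Qed.

Definition word_crossing_map i ks : {linear pol -> pol} := HB.pack (word_crossing i ks)
  (GRing.isLinear.Build K pol pol _ (word_crossing i ks) (word_crossing_is_linear i ks)).

(** In a vanishing combination take a longest [w] whose polynomial [F w] is
    nonzero: the other words contribute nothing to the coefficient at the
    leading automorphism of [w]. *)
Lemma word_crossing_independent i (T : finType) (w : T -> 'S_n)
    (red : T -> seq 'I_n.-1) (F : T -> pol) :
  injective w -> (forall t, reduced_expression (w t) (red t)) ->
  (forall f, \sum_t word_crossing i (red t) (F t * f) = 0) ->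
  forall t, F t = 0.
Proof.
move=> w_inj redP F0 t1; apply/eqP; apply: contraT => nz1.
have redw t : word_perm (red t) = w t by case: (redP t).
have redr t : reduced (red t) by case: (reduced_expression_word (redP t)).
have sz t : size (red t) = perm_length (w t) by rewrite -redw; apply/esym/eqP/redr.
have /boolp.choice[c cP] : forall t, exists c,
    expands (size (red t)) (word_crossing i (red t)) c /\
    leading_part D i (w t) (size (red t)) c.
  by move=> t; have [c c1 c2] := word_expansion K O i (redr t); exists c; rewrite -redw.
have [t0 nz0 max0] : exists2 t0, F t0 != 0 &
    forall t, F t != 0 -> (size (red t) <= size (red t0))%N.
  by case: (@arg_maxnP T t1 (fun t => F t != 0) (fun t => size (red t)) nz1) => t2 nz2 mx; exists t2.
pose N := (\max_t size (red t))%N.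
have leN t : (size (red t) <= N)%N by apply: (leq_bigmax t).
(* The expansions are brought to the common denominator [discriminant ^+ N]. *)
pose E (a : 'S_n * 'S_n) := \sum_t discriminant K nu ^+ (N - size (red t)) *
  (c t a * permute a.1 a.2 (F t)).
have E0 a : E a = 0.
  apply: (permute_independent (c := E) (index_enum_uniq _)) (mem_index_enum a) => f.
  transitivity (discriminant K nu ^+ N *
      \sum_t word_crossing i (red t) (F t * f)); last by rewrite F0 mulr0.
  rewrite mulr_sumr; under eq_bigr do rewrite /E mulr_suml.
  rewrite exchange_big /=; apply: eq_bigr => t _.
  rewrite -{2}(subnK (leN t)) exprD -[RHS]mulrA (cP t).1 [RHS]mulr_sumr.
  apply: eq_bigr => a' _; rewrite permuteM.
  by rewrite -[LHS]mulrA; congr (_ * _); rewrite mulrA.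
have [_ [_ _ [q0 cq0 _]]] := cP t0.
have := E0 (w t0, q0); rewrite /E (bigD1 t0) //= big1 ?addr0 => [|t tt0].
  move/eqP; rewrite !mulf_eq0 permute_eq0 (negPf cq0) (negPf nz0) !orbF.
  by rewrite expf_eq0 (negPf (discriminant_neq0 K nu)) andbF.
have [->|nzt] := eqVneq (F t) 0; first by rewrite permute_0 !mulr0.
suff -> : c t (w t0, q0) = 0 by rewrite mul0r mulr0.
apply/eqP; apply: contraT => /(let: And3 h _ _ := (cP t).2 in h)[e|].
  by rewrite (w_inj _ _ e) eqxx in tt0.
by rewrite -sz ltnNge max0.
Qed.

(** For each permutation the dots contribute a polynomial [F w], whose
    coefficients are those of the combination. *)
Lemma basis_element_independent (act : klr K D nu -> Pol -> Pol) i j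
    (red : transporter i j -> seq 'I_n.-1)
    (ts : seq (transporter i j * exponents)) (c : transporter i j * exponents -> K) :
  polynomial_representation O act ->
  (forall w, reduced_expression (val w) (red w)) -> uniq ts ->
  (forall g, act (\sum_(t <- ts) c t *: basis_element K D i (red t.1) t.2) g = 0) ->
  forall t, t \in ts -> c t = 0.
Proof.
move=> rep redP uts c0.
pose F (w : transporter i j) : pol :=
  \sum_(t <- ts | t.1 == w) c t *: x_monomial t.2.
have F0 w : F w = 0.
  apply: (word_crossing_independent (i := i) (w := val) (red := red)) => // [|f].
    exact: val_inj.
  transitivity (act (\sum_(t <- ts) c t *: basis_element K D i (red t.1) t.2)
                  (single i f) j); last by rewrite c0 ffunE.
  rewrite (act_linear_sum rep) sum_ffunE.
  under [RHS]eq_bigr => t _.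
    rewrite (act_linearZ rep) (act_basis_element rep) singleE.
    have -> : seq_act (word_perm (red t.1)) i = j.
      by have [-> _] := redP t.1; exact: (eqP (proj2_sig t.1)).
    over.
  transitivity (\sum_w \sum_(t <- ts | t.1 == w)
      c t *: word_crossing i (red t.1) (x_monomial t.2 * f)).
    apply: eq_bigr => w' _; rewrite /F mulr_suml.
    rewrite -[LHS]/(word_crossing_map i (red w') _) linear_sum /=.
    apply: eq_bigr => t /eqP <-; rewrite -scalerAl.
    exact: (linearZ_LR (word_crossing_map i (red t.1))).
  rewrite (exchange_big_dep predT) //=; apply: eq_bigr => t _.
  rewrite (eq_bigl (xpred1 t.1)) => [|w']; last by rewrite eq_sym.
  by rewrite big_pred1_eq ffunE singleE.
move=> t tts; have := congr1 (mcoeff (x_exponent t.2)) (F0 t.1).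
rewrite mcoeff0 /F linear_sum /= big_mkcond (bigD1_seq t) //= eqxx.
rewrite mcoeffZ x_monomialE mcoeffX eqxx mulr1 big1 ?addr0 // => s st.
case: ifP => // /eqP s1; rewrite mcoeffZ x_monomialE mcoeffX (inj_eq x_exponent_inj).
have -> : (s.2 == t.2) = false.
  apply: contraNF st => /eqP s2; apply/eqP.
  by rewrite [s]surjective_pairing [t]surjective_pairing s1 s2.
by rewrite mulr0.
Qed.

End Independence.
(** * Straightening words *)

Section Straightening.
Context (I : finType) (D : bc_datum I) (nu : {ffun I -> nat}).
Context (S : pzRingType) (A : pzRingType).

Local Notation n := (ht nu).
Local Notation Seq := (Seq nu).
Local Notation s k i := (seq_act (simple k) i).
Implicit Types (i j : Seq) (k l : 'I_n.-1) (u v : 'I_n) (ks : seq 'I_n.-1).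
Implicit Types (m : {ffun 'I_n -> nat}) (w : 'S_n).

Local Open Scope ring_scope.

(** Elements of an arbitrary ring that satisfy the defining relations; [sc]
    provides central scalars. Spanning only uses these identities. *)
Record klr_family (sc : S -> A) (E : Seq -> A) (X : 'I_n -> A) (T : 'I_n.-1 -> A) :
    Prop := {
  scalar_one : sc 1 = 1;
  scalar_opp : forall c, sc (- c) = - sc c;
  scalar_mul : forall c d, sc (c * d) = sc c * sc d;
  scalar_central : forall c y, sc c * y = y * sc c;
  idem_mul : forall i j, E i * E j = if i == j then E i else 0;
  idem_sum : \sum_i E i = 1;
  dot_idem : forall u i, X u * E i = E i * X u;
  cross_idem : forall k i j,
    E j * (T k * E i) = if j == s k i then T k * E i else 0;
  dot_comm : forall u v, X u * X v = X v * X u;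
  cross_dot_far : forall k u, u != pos k -> u != posS k -> T k * X u = X u * T k;
  cross_far : forall k l, (k.+1 < l)%N || (l.+1 < k)%N -> T k * T l = T l * T k;
  cross_square : forall k i,
    let a := entry i (pos k) in
    let b := entry i (posS k) in
    T k * T k * E i =
    if a == b then 0 else if dotp D a b == 0 then E i
    else (X (pos k) ^+ expo D a b + X (posS k) ^+ expo D b a) * E i;
  cross_slide_left : forall k i,
    (X (pos k) * T k - T k * X (posS k)) * E i =
    if (entry i (pos k) == entry i (posS k)) && plus_vertex D (entry i (pos k))
    then E i else 0;
  cross_slide_right : forall k i,
    (T k * X (pos k) - X (posS k) * T k) * E i =
    if (entry i (pos k) == entry i (posS k)) && plus_vertex D (entry i (pos k))
    then E i else 0;
  cross_braid : forall k l i, l = k.+1 :> nat ->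
    let a := entry i (pos k) in
    let b := entry i (pos l) in
    let c := entry i (posS l) in
    (T k * T l * T k - T l * T k * T l) * E i =
    if [&& a == c, plus_vertex D a, b != a & dotp D a b != 0]
    then \sum_(d < expo D a b)
           X (pos k) ^+ d * X (posS l) ^+ (expo D a b - 1 - d) * E i
    else 0
}.

Context (sc : S -> A) (E : Seq -> A) (X : 'I_n -> A) (T : 'I_n.-1 -> A).
Context (fam : klr_family sc E X T).
Implicit Types (y z : A).

Definition word_T ks : A := \prod_(k <- ks) T k.
Definition monomial_X m : A := \prod_(u < n) X u ^+ m u.

Lemma word_T_cons k ks : word_T (k :: ks) = T k * word_T ks.
Proof. by rewrite /word_T big_cons. Qed.

Lemma idem_word_T ks i j : E j * (word_T ks * E i) =
  if j == seq_act (word_perm ks) i then word_T ks * E i else 0.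
Proof.
elim: ks j => [|k ks IH] j.
  rewrite /word_T big_nil mul1r seq_act1 (idem_mul fam).
  by case: eqVneq => // ->.
set Y := word_T ks * E i; have YE : E (seq_act (word_perm ks) i) * Y = Y.
  by rewrite IH eqxx.
rewrite word_T_cons -mulrA -/Y -{1}YE (mulrA (T k)) (mulrA (E j)).
rewrite (cross_idem fam) seq_actM.
by case: eqP => _; rewrite ?mul0r // -mulrA YE.
Qed.

(** The combinations of words of fewer than [r] crossings, each followed by a
    monomial in the dots at the source. *)
Inductive filtration i : nat -> A -> Prop :=
| filtration0 r : filtration i r 0
| filtration_step r c ks m y : (size ks < r)%N -> filtration i r y ->
    filtration i r (sc c * (word_T ks * E i * monomial_X m) + y).

Lemma filtrationD i r y z : filtration i r y -> filtration i r z ->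
  filtration i r (y + z).
Proof.
elim=> [r'|r' c ks m y' sr _ IH] fz; first by rewrite add0r.
by rewrite -addrA; apply: filtration_step (IH fz).
Qed.

Lemma filtration_word i r ks m : (size ks < r)%N ->
  filtration i r (word_T ks * E i * monomial_X m).
Proof.
move=> sr; rewrite -[_ * _]addr0 -[X in X + _]mul1r -(scalar_one fam).
exact: filtration_step (filtration0 _ _).
Qed.

(** A map that commutes with scalars is controlled by its values on words. *)
Lemma filtration_map (h : A -> A) i r r' y :
  h 0 = 0 -> (forall c x z, h (sc c * x + z) = sc c * h x + h z) ->
  (forall ks m, (size ks < r)%N -> filtration i r' (h (word_T ks * E i * monomial_X m))) ->
  filtration i r y -> filtration i r' (h y).
Proof.
move=> h0 hl hw fy; elim: fy hw => [r1|r1 c ks m z sr _ IH] hw.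
  by rewrite h0; exact: filtration0.
rewrite hl; apply: filtrationD; last exact: IH.
elim: (hw ks m sr) => [r2|r2 d ks' m' x sr' _ IHx].
  by rewrite mulr0; exact: filtration0.
by rewrite mulrDr mulrA -(scalar_mul fam); exact: filtration_step.
Qed.

Lemma filtration_leq i r r' y : (r <= r')%N -> filtration i r y -> filtration i r' y.
Proof.
move=> rr'; apply: (filtration_map (h := id)) => // ks m sr.
by apply: filtration_word; apply: leq_trans rr'.
Qed.

Lemma filtration_scale i r c y : filtration i r y -> filtration i r (sc c * y).
Proof.
apply: (filtration_map (h := *%R (sc c))) => [|d x z|ks m sr]; first exact: mulr0.
  by rewrite mulrDr mulrA (scalar_central fam _ (sc d)) -mulrA.
by rewrite -[_ * _]addr0; apply: filtration_step (filtration0 _ _).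
Qed.

Lemma filtrationN i r y : filtration i r y -> filtration i r (- y).
Proof.
move=> fy; rewrite -mulN1r -(scalar_one fam) -(scalar_opp fam).
exact: filtration_scale.
Qed.

Lemma filtrationB i r y z : filtration i r y -> filtration i r z ->
  filtration i r (y - z).
Proof. by move=> fy /filtrationN; exact: filtrationD. Qed.

Lemma filtration_sum (J : finType) i r (h : J -> A) :
  (forall t, filtration i r (h t)) -> filtration i r (\sum_t h t).
Proof.
by move=> fh; elim/big_ind: _ => // [|y z]; [exact: filtration0|exact: filtrationD].
Qed.

Lemma filtration_mull i r r' x y :
  (forall ks m, (size ks < r)%N -> filtration i r' (x * (word_T ks * E i * monomial_X m))) ->
  filtration i r y -> filtration i r' (x * y).
Proof.
apply: filtration_map; first exact: mulr0.
by move=> c z z'; rewrite mulrDr !mulrA (scalar_central fam).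
Qed.

Lemma filtration_T i r k y : filtration i r y -> filtration i r.+1 (T k * y).
Proof.
apply: filtration_mull => ks m sr; rewrite !mulrA -word_T_cons.
exact: filtration_word.
Qed.

Lemma filtration_E i r j y : filtration i r y -> filtration i r (E j * y).
Proof.
apply: filtration_mull => ks m sr; rewrite mulrA idem_word_T.
by case: ifP => _; [exact: filtration_word|rewrite mul0r; exact: filtration0].
Qed.

(** Membership may be tested after cutting [y] by the idempotents, which is how
    the relations are stated. *)
Lemma filtration_cut i r x y : (forall j, filtration i r (x * E j * y)) ->
  filtration i r (x * y).
Proof.
move=> f; rewrite -[y]mul1r -(idem_sum fam) mulr_suml mulr_sumr.
by apply: filtration_sum => j; rewrite mulrA.
Qed.

Lemma monomial_X_comm u m : GRing.comm (X u) (monomial_X m).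
Proof. apply: commr_prod => v _; apply: commrX; exact: (dot_comm fam). Qed.

Lemma monomial_X_mul u m : exists m', X u * monomial_X m = monomial_X m'.
Proof.
exists [ffun v => m v + (v == u)]%N.
have gen (r : seq 'I_n) : uniq r ->
    \prod_(v <- r) X v ^+ (m v + (v == u)) =
    (if u \in r then X u else 1) * (\prod_(v <- r) X v ^+ m v).
  elim: r => [|v r IH] /= => [_|/andP[vr /IH e]].
    by rewrite !big_nil mulr1.
  rewrite !big_cons e in_cons; have [->|vu] := eqVneq u v.
    by rewrite (negPf vr) mul1r /= addn1 exprS mulrA.
  rewrite addn0 /= !mulrA; congr (_ * _).
  case: (u \in r); rewrite ?mulr1 ?mul1r //.
  by apply/commr_sym/commrX; exact: (dot_comm fam).
rewrite /monomial_X -[X u](_ : (if u \in index_enum _ then X u else 1) = _).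
  by rewrite -gen ?index_enum_uniq //; apply: eq_bigr => v _; rewrite ffunE.
by rewrite mem_index_enum.
Qed.

Lemma filtration_mulr_X i r u y : filtration i r y -> filtration i r (y * X u).
Proof.
apply: (filtration_map (h := *%R^~ (X u))) => [|c x z|ks m sr]; first exact: mul0r.
  by rewrite mulrDl mulrA.
have [m' me] := monomial_X_mul u m.
by rewrite -mulrA -monomial_X_comm me; exact: filtration_word.
Qed.

Lemma filtration_mulr i r m y : filtration i r y -> filtration i r (y * monomial_X m).
Proof.
rewrite /monomial_X; elim: (index_enum _) y => [|u us IH] y fy.
  by rewrite big_nil mulr1.
rewrite big_cons mulrA; apply: IH; elim: (m u) => [|d IHd]; first by rewrite mulr1.
by rewrite exprSr mulrA; exact: filtration_mulr_X.
Qed.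

(** A dot slides to the right end of a word; each correction has one crossing
    fewer. *)
Lemma filtration_X_word i u ks m :
  filtration i (size ks).+1 (X u * (word_T ks * E i * monomial_X m)).
Proof.
elim: ks u => [|k ks IH] u.
  rewrite /word_T big_nil mul1r mulrA (dot_idem fam) -mulrA.
  have [m' ->] := monomial_X_mul u m.
  have -> : E i = word_T [::] * E i by rewrite /word_T big_nil mul1r.
  exact: filtration_word.
rewrite word_T_cons -(mulrA (T k)) -(mulrA (T k)); set Y := word_T ks * _ * _.
have fX v : filtration i (size ks).+1 (X v * Y) by exact: IH.
have fTX v : filtration i (size ks).+2 (T k * (X v * Y)) by exact: filtration_T.
have fY : filtration i (size ks).+2 Y.
  exact: filtration_word.
rewrite mulrA; apply: filtration_cut => j.
have fE v : filtration i (size ks).+2 (T k * X v * E j * Y).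
  rewrite -!mulrA; apply: filtration_T; rewrite mulrA (dot_idem fam) -mulrA.
  exact: filtration_E.
have fif (c : bool) : filtration i (size ks).+2 ((if c then E j else 0) * Y).
  by case: c; [exact: filtration_E|rewrite mul0r; exact: filtration0].
have [->|uk] := eqVneq u (pos k).
  rewrite -[X _ * T k](subrK (T k * X (posS k))) mulrDl (cross_slide_left fam) mulrDl.
  exact: filtrationD.
have [->|uk'] := eqVneq u (posS k).
  rewrite -[X _ * T k](subKr (T k * X (pos k))) mulrBl (cross_slide_right fam) mulrBl.
  exact: filtrationB.
by rewrite -(cross_dot_far fam uk uk').
Qed.

Lemma filtration_X i r u y : filtration i r y -> filtration i r (X u * y).
Proof.
apply: filtration_mull => ks m sr.
exact: filtration_leq sr (filtration_X_word i u ks m).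
Qed.

Lemma filtration_Xn i r u d y : filtration i r y -> filtration i r (X u ^+ d * y).
Proof.
move=> fy; elim: d => [|d IH]; first by rewrite mul1r.
by rewrite exprS -mulrA; exact: filtration_X.
Qed.

Lemma filtration_square i r k y : filtration i r y -> filtration i r (T k * (T k * y)).
Proof.
move=> fy; rewrite mulrA; apply: filtration_cut => j; rewrite (cross_square fam).
case: ifP => _; first by rewrite mul0r; exact: filtration0.
case: ifP => _; first exact: filtration_E.
rewrite -mulrA mulrDl.
by apply: filtrationD; apply: filtration_Xn; exact: filtration_E.
Qed.

Lemma filtration_braid i r k l y : l = k.+1 :> nat -> filtration i r y ->
  filtration i r (T k * (T l * (T k * y)) - T l * (T k * (T l * y))).
Proof.
move=> lk fy; rewrite !mulrA -mulrBl; apply: filtration_cut => j.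
rewrite (cross_braid fam j lk); case: ifP => _; last first.
  by rewrite mul0r; exact: filtration0.
rewrite mulr_suml; apply: filtration_sum => d; rewrite -!mulrA.
by do 2!apply: filtration_Xn; exact: filtration_E.
Qed.

Lemma filtration_word1 i r ks : (size ks < r)%N -> filtration i r (word_T ks * E i).
Proof.
move=> sr; have := filtration_word i [ffun=> 0%N] sr.
rewrite /monomial_X big1 ?mulr1 // => u _; by rewrite ffunE.
Qed.

(** Matsumoto's argument: two distinct left descents of [w] generate a dihedral
    group whose longest element splits off, so that [w] has reduced words
    starting with either descent which differ by one relation. *)
Lemma two_descents i w k l : k != l -> descent w k -> descent w l ->
  exists ks ls, [/\ reduced ks, word_perm ks = (w * simple k)%g,
    reduced ls, word_perm ls = (w * simple l)%g
    & filtration i (perm_length w)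
        (T k * (word_T ks * E i) - T l * (word_T ls * E i))].
Proof.
have adj (k' l' : 'I_n.-1) : l' = k'.+1 :> nat -> descent w k' -> descent w l' ->
    exists ks ls, [/\ reduced ks, word_perm ks = (w * simple k')%g,
      reduced ls, word_perm ls = (w * simple l')%g
      & filtration i (perm_length w)
          (T k' * (word_T ks * E i) - T l' * (word_T ls * E i))].
  move=> lk dk dl; have sl := adj_pos lk.
  have lk' : simple l' (posS k') = posS l' by rewrite -sl simple_pos.
  have lw := perm_length_descent dk; have lwl := perm_length_descent dl.
  have d2 : descent (w * simple k')%g l'.
    rewrite /descent !mulV_simple adj_simple_posS // sl simple_posS.
    by apply: ltn_trans dl _; rewrite sl.
  have lw2 := perm_length_descent d2.
  have d3 : descent (w * simple k' * simple l')%g k'.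
    rewrite /descent !mulV_simple lk' adj_simple_posS // adj_simple_pos // simple_pos.
    by rewrite -sl.
  have lw3 := perm_length_descent d3.
  have [z [wz sz]] := shortest_word (w * simple k' * simple l' * simple k')%g.
  exists [:: l', k' & z], [:: k', l' & z].
  have w1 : word_perm [:: l', k' & z] = (w * simple k')%g by rewrite /= wz !mul_simpleK.
  have w2 : word_perm [:: k', l' & z] = (w * simple l')%g.
    by rewrite /= wz -!(mulgA w) (simple_braid lk) !mulgA !mul_simpleK.
  split=> //.
  - by apply/eqP; rewrite w1 /=; lia.
  - by apply/eqP; rewrite w2 /=; lia.
  rewrite !word_T_cons -!mulrA; apply: filtration_braid lk _.
  by apply: filtration_word1; lia.
have far (k' l' : 'I_n.-1) : (k'.+1 < l')%N || (l'.+1 < k')%N ->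
    descent w k' -> descent w l' ->
    exists ks ls, [/\ reduced ks, word_perm ks = (w * simple k')%g,
      reduced ls, word_perm ls = (w * simple l')%g
      & filtration i (perm_length w)
          (T k' * (word_T ks * E i) - T l' * (word_T ls * E i))].
  move=> kl dk dl.
  have lw := perm_length_descent dk; have lwl := perm_length_descent dl.
  have d2 : descent (w * simple k')%g l' by rewrite /descent !mulV_simple !far_fix.
  have lw2 := perm_length_descent d2.
  have [z [wz sz]] := shortest_word (w * simple k' * simple l')%g.
  exists (l' :: z), (k' :: z).
  have w1 : word_perm (l' :: z) = (w * simple k')%g by rewrite /= wz mul_simpleK.
  have w2 : word_perm (k' :: z) = (w * simple l')%g.
    by rewrite /= wz -!(mulgA w) (simple_comm kl) !mulgA !mul_simpleK.
  split=> //.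
  - by apply/eqP; rewrite w1 /=; lia.
  - by apply/eqP; rewrite w2 /=; lia.
  rewrite !word_T_cons -!mulrA (mulrA (T k')) (cross_far fam kl) -mulrA subrr.
  exact: filtration0.
move=> kl dk dl; have [klt|lkt|e] := ltngtP (k : nat) l; last first.
- by rewrite (val_inj e) eqxx in kl.
- have [e|e] := eqVneq (l.+1) (k : nat).
    have [ks [ls [r1 w1 r2 w2 f]]] := adj l k (esym e) dl dk.
    exists ls, ks; split=> //; rewrite -opprB; exact: filtrationN.
  by apply: far => //; rewrite orbC ltn_neqAle e lkt.
have [e|e] := eqVneq (k.+1) (l : nat); first exact: adj (esym e) dk dl.
by apply: far => //; rewrite ltn_neqAle e klt.
Qed.

(** If the first letters differ, both words are compared, through shorter words,
    with the two words given by [two_descents]. *)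
Lemma reduced_words_congruent i ks ls :
  reduced ks -> reduced ls -> word_perm ks = word_perm ls ->
  filtration i (size ks) (word_T ks * E i - word_T ls * E i).
Proof.
have [r] := ubnP (size ks); elim: r ks ls => // r IH ks ls.
rewrite ltnS => sr rk rl kl; have skl : size ks = size ls.
  by move/eqP: rk => <-; move/eqP: rl => <-; rewrite kl.
case: ks sr rk kl skl => [|k u] sr rk kl skl.
  by move/esym/size0nil: skl => ->; rewrite subrr; exact: filtration0.
case: ls rl kl skl => [//|l v] rl kl [skl].
have [ru _] := reduced_cons rk; have [rv _] := reduced_cons rl.
have step (k' : 'I_n.-1) (x ls : seq 'I_n.-1) : size x = size u -> reduced x ->
    reduced ls -> word_perm x = word_perm ls ->
    filtration i (size u).+1 (T k' * (word_T x * E i - word_T ls * E i)).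
  move=> sx rx ry xy; rewrite -sx; apply: filtration_T; apply: IH => //.
  by rewrite sx.
rewrite !word_T_cons -!mulrA /=; have [ekl|nkl] := eqVneq k l.
  rewrite -ekl -mulrBr; apply: step => //; move: kl => /=; rewrite ekl.
  exact: mulIg.
have [x [ls [rx wx ry wy f]]] : exists x ls, [/\ reduced x,
    word_perm x = word_perm u, reduced ls, word_perm ls = word_perm v
    & filtration i (size u).+1 (T k * (word_T x * E i) - T l * (word_T ls * E i))].
  have dk := descent_cons rk; have dl := descent_cons rl; rewrite -kl in dl.
  have [x [ls [rx wx ry wy f]]] := two_descents i nkl dk dl.
  exists x, ls; split=> //; last by move: f; rewrite (eqP rk).
    by rewrite wx /= mul_simpleK.
  by rewrite wy kl /= mul_simpleK.
have := filtrationB (filtrationD (step k u x erefl ru rx (esym wx)) f)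
  (step l v ls (esym skl) rv ry (esym wy)).
by rewrite !mulrBr addrA subrK opprB addrA subrK.
Qed.

(** A reduced word that becomes nonreduced with one more letter [k] is congruent
    to a word that starts with [k], and a repeated letter is removed by the
    relation for the square of a crossing. *)
Lemma nonreduced_word i ks : ~~ reduced ks -> filtration i (size ks) (word_T ks * E i).
Proof.
elim: ks => [|k ks IH]; first by rewrite /reduced /= perm_length1.
rewrite reduced_consE negb_and negbK word_T_cons -mulrA.
have [rk /= d|/IH f _] := boolP (reduced ks); last exact: filtration_T.
have [z [wz sz]] := shortest_word (word_perm ks * simple k)%g.
have rz : reduced (k :: z).
  by apply/eqP; rewrite /= wz mul_simpleK sz (perm_length_descent d).
have szk : size ks = (size z).+1 by rewrite -(eqP rk) (perm_length_descent d) sz.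
rewrite -[word_T ks * E i](subrK (word_T (k :: z) * E i)) mulrDr.
apply: filtrationD; first apply/filtration_T/reduced_words_congruent => //=.
  by rewrite wz mul_simpleK.
rewrite word_T_cons -mulrA; apply: filtration_square.
by apply: filtration_word1; rewrite szk.
Qed.

(** Induction on the filtration: modulo shorter words, a word is either zero or
    the chosen reduced expression of its permutation. *)
Lemma filtration_spanned (B : A -> Prop) i j (red : transporter i j -> seq 'I_n.-1) r y :
  (forall t, reduced_expression (val t) (red t)) ->
  B 0 -> (forall x z, B x -> B z -> B (x + z)) ->
  (forall c t m, B (sc c * (word_T (red t) * E i * monomial_X m))) ->
  filtration i r y -> B (E j * y).
Proof.
move=> redP B0 BD Bw; elim: r y => [|r IH] y.
  by move e : 0%N => N fy; elim: fy e => [r1 _|r1 c ks m z + _ _ e]; rewrite ?mulr0 -?e.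
move e : r.+1 => N fy; elim: fy e => [r1 _|r1 c ks m z sr _ IHz Ne].
  by rewrite mulr0.
rewrite mulrDr; apply: (BD); last exact: IHz.
have lower x : filtration i (size ks) x -> B (E j * (sc c * (x * monomial_X m))).
  move=> fx; apply: IH; apply: filtration_leq (_ : (size ks <= r)%N) _; first lia.
  exact/filtration_scale/filtration_mulr.
have cut x : E j * (sc c * x) = sc c * (E j * x).
  by rewrite !mulrA (scalar_central fam).
have [rk|nr] := boolP (reduced ks); last exact/lower/nonreduced_word.
have [kj|kj] := eqVneq j (seq_act (word_perm ks) i); last first.
  rewrite cut (mulrA (E j)) idem_word_T (negPf kj).
  by rewrite mul0r mulr0.
have tP : seq_act (word_perm ks) i == j by rewrite -kj.
pose t : transporter i j := exist _ (word_perm ks) tP.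
have [wt rt] := reduced_expression_word (redP t).
rewrite -[word_T ks * E i](subrK (word_T (red t) * E i)) mulrDl 2!mulrDr.
apply: (BD); first exact/lower/reduced_words_congruent.
rewrite cut (mulrA (E j)) idem_word_T wt /= -kj eqxx.
exact: Bw.
Qed.

Lemma monomial_at_idem i m y :
  y * E i * \prod_(u < n) (X u * E i) ^+ m u = y * E i * monomial_X m.
Proof.
rewrite -!mulrA; congr (_ * _); rewrite /monomial_X.
elim: (index_enum _) => [|u r IH]; first by rewrite !big_nil.
have EX d : E i * X u ^+ d = X u ^+ d * E i.
  exact/commrX/commr_sym/(dot_idem fam).
have ED d : E i * (X u * E i) ^+ d = X u ^+ d * E i.
  elim: d => [|d IHd]; first by rewrite mulr1 mul1r.
  rewrite exprSr mulrA IHd -(mulrA (X u ^+ d)) (mulrA (E i)) -(dot_idem fam).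
  by rewrite -(mulrA (X u)) (idem_mul fam) eqxx mulrA -exprSr.
by rewrite !big_cons !(mulrA (E i)) EX ED -!mulrA IH.
Qed.

Lemma word_corner i j ks m : seq_act (word_perm ks) i = j ->
  E j * (word_T ks * E i * monomial_X m) * E i = word_T ks * E i * monomial_X m.
Proof.
move=> <-; have EM : E i * monomial_X m = monomial_X m * E i.
  by apply: commr_prod => u _; apply/commrX/commr_sym/(dot_idem fam).
by rewrite (mulrA (E _)) idem_word_T eqxx -!mulrA EM (mulrA (E i)) EM -mulrA (idem_mul fam) eqxx.
Qed.

End Straightening.
(** * The algebra as a family satisfying the relations *)

Section Spanning.
Context (K : closedFieldType) (I : finType) (D : bc_datum I).
Context (nu : {ffun I -> nat}).

Local Notation n := (ht nu).
Local Notation Seq := (Seq nu).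
Local Notation F := (free_alg K (generators nu)).
Local Notation R := (klr K D nu).
Local Notation exponents := {ffun 'I_n -> nat}.
Local Notation E := (@idem K I D nu).
Local Notation pi := (presented_pi (@klr_relation K I D nu)).
Local Notation s k i := (seq_act (simple k) i).
Implicit Types (i j : Seq) (k l : 'I_n.-1) (u v : 'I_n) (ks : seq 'I_n.-1).
Implicit Types (m : exponents) (a b y : R).

Local Open Scope ring_scope.

Definition X u : R := \sum_i dot K D u i.
Definition T k : R := \sum_i cross K D k i.

Lemma pi0 : pi 0 = 0.
Proof. by apply: (addrI (pi 0)); rewrite -presented_piD !addr0. Qed.

Lemma piB (x z : F) : pi (x - z) = pi x - pi z.
Proof. by apply: (addIr (pi z)); rewrite -presented_piD !subrK. Qed.

Lemma pi_sum (J : Type) (r : seq J) (h : J -> F) :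
  pi (\sum_(t <- r) h t) = \sum_(t <- r) pi (h t).
Proof. exact: (big_morph pi (presented_piD (@klr_relation K I D nu)) pi0). Qed.

(** The images of the relations are assembled from the images of their parts;
    rewriting with the morphism [pi] inside sums and products is avoided. *)
Definition maps (x : F) a := pi x = a.

Lemma maps_mul (x z : F) a b : maps x a -> maps z b -> maps (x * z) (a * b).
Proof. by move=> <- <-; exact: presented_piM. Qed.

Lemma maps_add (x z : F) a b : maps x a -> maps z b -> maps (x + z) (a + b).
Proof. by move=> <- <-; exact: presented_piD. Qed.

Lemma maps_sub (x z : F) a b : maps x a -> maps z b -> maps (x - z) (a - b).
Proof. by move=> <- <-; exact: piB. Qed.

Lemma maps_exp (x : F) a d : maps x a -> maps (x ^+ d) (a ^+ d).
Proof.
move=> xa; elim: d => [//|d IH]; rewrite !exprS; exact: maps_mul.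
Qed.

Lemma maps_if (c : bool) (x z : F) a b :
  maps x a -> maps z b -> maps (if c then x else z) (if c then a else b).
Proof. by case: c. Qed.

Lemma maps_sum (J : finType) (h : J -> F) (g : J -> R) :
  (forall t, maps (h t) (g t)) -> maps (\sum_t h t) (\sum_t g t).
Proof. by move=> hg; rewrite /maps pi_sum; apply: eq_bigr => t _; exact: hg. Qed.

Lemma maps_dots u : maps (\sum_i dot_gen K u i) (X u).
Proof. exact: pi_sum. Qed.

Lemma maps_crosses k : maps (\sum_i cross_gen K k i) (T k).
Proof. exact: pi_sum. Qed.

Lemma maps_idem i : maps (idem_gen K i) (E i).
Proof. by []. Qed.

Lemma maps_dot u i : maps (dot_gen K u i) (dot K D u i).
Proof. by []. Qed.

Lemma maps_cross k i : maps (cross_gen K k i) (cross K D k i).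
Proof. by []. Qed.

Lemma maps_relation (x z : F) a b :
  klr_relation D x z -> maps x a -> maps z b -> a = b.
Proof. by move=> xz <- <-; exact/presented_piP/relation_ideal_gen. Qed.

Lemma E_mul i j : E i * E j = if i == j then E i else 0.
Proof.
exact: maps_relation (rel_idem K D i j) (maps_mul (maps_idem i) (maps_idem j))
  (maps_if (i == j) (maps_idem i) pi0).
Qed.

Lemma E_sum : \sum_i E i = 1.
Proof. exact: maps_relation (Defs.rel_unit K D nu) (maps_sum maps_idem) erefl. Qed.

Lemma dot_ends u i : E i * dot K D u i * E i = dot K D u i.
Proof.
exact: maps_relation (rel_dot_ends K D u i)
  (maps_mul (maps_mul (maps_idem i) (maps_dot u i)) (maps_idem i)) (maps_dot u i).
Qed.

Lemma cross_ends k i : E (s k i) * cross K D k i * E i = cross K D k i.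
Proof.
exact: maps_relation (rel_cross_ends K D k i)
  (maps_mul (maps_mul (maps_idem (s k i)) (maps_cross k i)) (maps_idem i))
  (maps_cross k i).
Qed.

Lemma X_comm u v : X u * X v = X v * X u.
Proof.
exact: maps_relation (rel_dot_dot K D u v) (maps_mul (maps_dots u) (maps_dots v))
  (maps_mul (maps_dots v) (maps_dots u)).
Qed.

Lemma T_X_far k u : u != pos k -> u != posS k -> T k * X u = X u * T k.
Proof.
move=> uk uk'; exact: maps_relation (rel_cross_dot K D uk uk')
  (maps_mul (maps_crosses k) (maps_dots u)) (maps_mul (maps_dots u) (maps_crosses k)).
Qed.

Lemma T_far k l : (k.+1 < l)%N || (l.+1 < k)%N -> T k * T l = T l * T k.
Proof.
move=> kl; exact: maps_relation (rel_cross_cross K D kl)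
  (maps_mul (maps_crosses k) (maps_crosses l)) (maps_mul (maps_crosses l) (maps_crosses k)).
Qed.

Lemma T_square k i :
  let a := entry i (pos k) in
  let b := entry i (posS k) in
  T k * T k * E i =
  if a == b then 0 else if dotp D a b == 0 then E i
  else (X (pos k) ^+ expo D a b + X (posS k) ^+ expo D b a) * E i.
Proof.
move=> a b; exact: maps_relation (rel_cross_square K D k i)
  (maps_mul (maps_mul (maps_crosses k) (maps_crosses k)) (maps_idem i))
  (maps_if (a == b) pi0 (maps_if (dotp D a b == 0) (maps_idem i)
    (maps_mul (maps_add (maps_exp _ (maps_dots _)) (maps_exp _ (maps_dots _)))
      (maps_idem i)))).
Qed.

Lemma slide_left k i :
  (X (pos k) * T k - T k * X (posS k)) * E i =
  if (entry i (pos k) == entry i (posS k)) && plus_vertex D (entry i (pos k))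
  then E i else 0.
Proof.
exact: maps_relation (rel_slide_left K D k i)
  (maps_mul (maps_sub (maps_mul (maps_dots _) (maps_crosses k))
    (maps_mul (maps_crosses k) (maps_dots _))) (maps_idem i))
  (maps_if _ (maps_idem i) pi0).
Qed.

Lemma slide_right k i :
  (T k * X (pos k) - X (posS k) * T k) * E i =
  if (entry i (pos k) == entry i (posS k)) && plus_vertex D (entry i (pos k))
  then E i else 0.
Proof.
exact: maps_relation (rel_slide_right K D k i)
  (maps_mul (maps_sub (maps_mul (maps_crosses k) (maps_dots _))
    (maps_mul (maps_dots _) (maps_crosses k))) (maps_idem i))
  (maps_if _ (maps_idem i) pi0).
Qed.

Lemma T_braid k l i : l = k.+1 :> nat ->
  let a := entry i (pos k) in
  let b := entry i (pos l) in
  let c := entry i (posS l) in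
  (T k * T l * T k - T l * T k * T l) * E i =
  if [&& a == c, plus_vertex D a, b != a & dotp D a b != 0]
  then \sum_(d < expo D a b) X (pos k) ^+ d * X (posS l) ^+ (expo D a b - 1 - d) * E i
  else 0.
Proof.
move=> lk a b c; exact: maps_relation (rel_braid K D i lk)
  (maps_mul (maps_sub
    (maps_mul (maps_mul (maps_crosses k) (maps_crosses l)) (maps_crosses k))
    (maps_mul (maps_mul (maps_crosses l) (maps_crosses k)) (maps_crosses l)))
    (maps_idem i))
  (maps_if _ (maps_sum (fun d : 'I_(expo D a b) => maps_mul (maps_mul
    (maps_exp d (maps_dots (pos k)))
    (maps_exp (expo D a b - 1 - d) (maps_dots (posS l)))) (maps_idem i))) pi0).
Qed.

Lemma X_E u i : X u * E i = dot K D u i.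
Proof.
rewrite /X mulr_suml (bigD1 i) //= big1 ?addr0 => [|j ji].
  by rewrite -{1}dot_ends -mulrA E_mul eqxx dot_ends.
by rewrite -dot_ends -mulrA E_mul (negPf ji) mulr0.
Qed.

Lemma E_X u i : E i * X u = dot K D u i.
Proof.
rewrite /X mulr_sumr (bigD1 i) //= big1 ?addr0 => [|j ji].
  by rewrite -{1}dot_ends !mulrA E_mul eqxx dot_ends.
by rewrite -dot_ends !mulrA E_mul eq_sym (negPf ji) !mul0r.
Qed.

Lemma X_E_comm u i : X u * E i = E i * X u.
Proof. by rewrite X_E E_X. Qed.

Lemma T_E k i : T k * E i = cross K D k i.
Proof.
rewrite /T mulr_suml (bigD1 i) //= big1 ?addr0 => [|j ji].
  by rewrite -{1}cross_ends -mulrA E_mul eqxx cross_ends.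
by rewrite -cross_ends -mulrA E_mul (negPf ji) mulr0.
Qed.

Lemma E_T_E k i j : E j * (T k * E i) = if j == s k i then T k * E i else 0.
Proof.
rewrite T_E; have [->|ji] := eqVneq j (s k i).
  by rewrite -{1}cross_ends !mulrA E_mul eqxx cross_ends.
by rewrite -cross_ends !mulrA E_mul (negPf ji) !mul0r.
Qed.

Lemma klr_family_klr : klr_family D (fun c : K => c *: (1 : R)) E X T.
Proof.
have scE (c : K) y : c *: (1 : R) * y = c *: y by rewrite -presented_scalerAl mul1r.
split.
- exact: scale1r.
- by move=> c; exact: scaleNr.
- by move=> c d; rewrite scE scalerA.
- by move=> c y; rewrite scE -presented_scalerAr mulr1.
- exact: E_mul.
- exact: E_sum.
- exact: X_E_comm.
- exact: E_T_E.
- exact: X_comm.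
- exact: T_X_far.
- exact: T_far.
- exact: T_square.
- exact: slide_left.
- exact: slide_right.
exact: T_braid.
Qed.

Local Notation fil := (filtration (fun c : K => c *: (1 : R)) E X T).

(** The filtration is stable under left multiplication by every generator. *)
Lemma filtration_exhaustive i (x : R) : exists r, fil i r (x * E i).
Proof.
have fam := klr_family_klr.
have [e ->] : exists e : F, x = pi e by have [e ->] := presented_repr x; exists e.
elim/free_alg_ind: e => [|e e' [r fa] [r' fb]|c gs].
- by exists 0%N; rewrite pi0 mul0r; exact: filtration0.
- exists (maxn r r'); rewrite presented_piD mulrDl.
  by apply: filtrationD; [apply: (filtration_leq fam) fa|apply: (filtration_leq fam) fb];
    rewrite ?leq_maxl ?leq_maxr.
suff [r f] : exists r, fil i r (pi (\prod_(g <- gs) free_gen K g) * E i).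
  exists r; rewrite presented_piZ -presented_scalerAl.
  rewrite -[_ * E i]mul1r presented_scalerAl.
  exact: (filtration_scale fam c f).
elim: gs => [|g gs [r f]].
  exists 1%N; rewrite big_nil mul1r.
  by have := filtration_word1 fam i (ks := [::]) (ltnSn 0); rewrite /word_T big_nil mul1r.
rewrite big_cons presented_piM -mulrA.
case: g => [[j|[u j]]|[k j]].
- exists r; exact: (filtration_E fam j f).
- exists r; rewrite -[pi _]/(dot K D u j) -X_E -mulrA.
  exact: (filtration_X fam u (filtration_E fam j f)).
exists r.+1; rewrite -[pi _]/(cross K D k j) -T_E -mulrA.
exact: (filtration_T fam k (filtration_E fam j f)).
Qed.

Lemma basis_elementE i ks (m : exponents) :
  basis_element K D i ks m = word_T T ks * E i * monomial_X X m.
Proof.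
apply: etrans (monomial_at_idem klr_family_klr i m (word_T T ks)).
have -> : \prod_(u < n) (X u * E i) ^+ m u = \prod_(u < n) dot K D u i ^+ m u.
  by apply: eq_bigr => u _; rewrite X_E.
by [].
Qed.

Lemma basis_element_corner i j ks (m : exponents) :
  seq_act (word_perm ks) i = j -> corner j i (basis_element K D i ks m).
Proof.
move=> ksj; exists (basis_element K D i ks m); rewrite basis_elementE.
exact: esym (word_corner klr_family_klr m ksj).
Qed.

(** Repeated basis elements are collected, so that linear independence applies to
    the resulting combination. *)
Lemma corner_spanned i j (red : transporter i j -> seq 'I_n.-1) (a : R) :
  (forall t, reduced_expression (val t) (red t)) -> corner j i a ->
  exists ts (c : transporter i j * exponents -> K), uniq ts /\
    a = \sum_(t <- ts) c t *: basis_element K D i (red t.1) t.2.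
Proof.
move=> redP [b ->]; have fam := klr_family_klr.
have [r f] := filtration_exhaustive i b.
pose B (y : R) := exists ps : seq (K * (transporter i j * exponents)),
  y = \sum_(p <- ps) p.1 *: basis_element K D i (red p.2.1) p.2.2.
have [ps psE] : B (E j * (b * E i)).
  apply: (filtration_spanned fam redP _ _ _ f).
  - by exists [::]; rewrite big_nil.
  - by move=> x z [ps ->] [qs ->]; exists (ps ++ qs); rewrite big_cat.
  move=> c t m; exists [:: (c, (t, m))]; rewrite big_seq1 /= basis_elementE.
  by rewrite -presented_scalerAl mul1r.
exists (undup (unzip2 ps)), (fun t => \sum_(p <- ps | p.2 == t) p.1).
split; first exact: undup_uniq.
rewrite -mulrA psE.
under [RHS]eq_bigr => t _ do rewrite scaler_suml.
rewrite (exchange_big_dep predT) //=; apply: eq_big_seq => p pps.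
rewrite big_mkcond (bigD1_seq p.2) ?undup_uniq ?mem_undup ?map_f //= eqxx.
by rewrite big1 ?addr0 // => t /negPf tp; rewrite eq_sym tp.
Qed.

Lemma E_decompose (a : R) : a = \sum_j \sum_i E j * a * E i.
Proof.
have sumE y : \sum_i y * E i = y by rewrite -mulr_sumr E_sum mulr1.
by rewrite -{1}[a]mul1r -E_sum mulr_suml; apply: eq_bigr => j _; rewrite sumE.
Qed.

Lemma klr_ring0 (a : R) : (forall i j, E j * a * E i = 0) -> a = 0.
Proof.
by move=> a0; rewrite [a]E_decompose; do 2!(apply: big1 => ? _); exact: a0.
Qed.

End Spanning.

Lemma transporter_reduced_words (I : finType) (nu : {ffun I -> nat}) (i j : Seq nu) :
  exists red : transporter i j -> seq 'I_(ht nu).-1,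
    forall w, reduced_expression (val w) (red w).
Proof.
have /boolp.choice[red redP] := fun w : transporter i j =>
  reduced_expression_exists (val w).
by exists red.
Qed.

Theorem proposition3p1 (K : closedFieldType) (I : finType) (D : bc_datum I)
    (O : orientation D) (nu : {ffun I -> nat}) :
  (forall (i j : Seq nu) (red : transporter i j -> seq 'I_(ht nu).-1),
     (forall w, reduced_expression (val w) (red w)) ->
     is_basis (corner (K := K) (D := D) j i)
       (fun wm : transporter i j * {ffun 'I_(ht nu) -> nat} =>
          basis_element K D i (red wm.1) wm.2)) /\
  (exists act : klr K D nu -> Pol K nu -> Pol K nu,
     polynomial_representation O act /\ faithful_action act).
Proof.
have rep := klr_act_representation K O nu.
split=> [i j red redP|].
  split.
  - move=> [t m]; apply: basis_element_corner.
    by have [-> _] := redP t; exact: (eqP (proj2_sig t)).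
  - move=> v /(corner_spanned redP)[ts [c [_ ->]]]; by exists ts, c.
  move=> ts c uts s0; apply: (basis_element_independent rep redP uts) => g.
  rewrite s0; exact: (act_0 rep).
exists (@klr_act K I D O nu); split=> // a a0; apply: klr_ring0 => i j.
have [red redP] := transporter_reduced_words i j.
have ja : corner j i (idem K D j * a * idem K D i)%R by exists a.
have [ts [c [uts e]]] := corner_spanned redP ja.
rewrite e big_seq big1 // => t tts.
rewrite (basis_element_independent rep redP uts _ tts) ?scale0r // => g.
rewrite -e (act_mul rep) (act_mul rep) a0; exact: (act_on_0 rep).
Qed.
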